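(* Let $G$ be a finite simple graph with $n$ vertices which is not the path $P_n$ on $n$ vertices. Then $\mathrm{reg}(J_G)\leq n-1$.
   Context: Let $K$ be a field and $S=K[x_1,\ldots,x_n,y_1,\ldots,y_n]$. For a finite simple graph $G$ on $[n]$, the binomial edge ideal $J_G\subseteq S$ is generated by $x_iy_j-x_jy_i$ for all edges $\{i,j\}$ of $G$ with $i<j$. $\mathrm{reg}$ denotes Castelnuovo–Mumford regularity, $\mathrm{reg}(M)=\max\{j-i:\beta_{i,j}(M)\neq0\}$ (with the zero ideal treated as having regularity at most any of the bounds considered). $P_n$ is the path with $n$ vertices and $n-1$ edges. *)

(* Defs.v *)
From HB Require Import structures.
From mathcomp Require Import all_boot all_order all_algebra.
From mathcomp Require Import perm.
From mathcomp Require Export mpoly.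
Set Implicit Arguments. Unset Strict Implicit. Unset Printing Implicit Defensive.
Import Order.TTheory GRing.Theory Num.Theory.
Local Open Scope ring_scope.

Definition simple_graph (n : nat) (e : rel 'I_n) : Prop :=
  irreflexive e /\ ssrbool.symmetric e.

Definition is_path_graph (n : nat) (e : rel 'I_n) : Prop :=
  exists s : {perm 'I_n}, forall u v : 'I_n,
    e u v = ((s u).+1 == s v)%N || ((s v).+1 == s u)%N.

Notation S K n := {mpoly K[n + n]}.

Definition xv (K : fieldType) (n : nat) (i : 'I_n) : S K n := 'X_(lshift n i).
Definition yv (K : fieldType) (n : nat) (i : 'I_n) : S K n := 'X_(rshift n i).

Definition fbin (K : fieldType) (n : nat) (i j : 'I_n) : S K n :=
  xv K i * yv K j - xv K j * yv K i.

Definition in_JG (K : fieldType) (n : nat) (e : rel 'I_n) (p : S K n) : Prop :=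
  exists c : 'I_n -> 'I_n -> S K n,
    p = \sum_(i < n) \sum_(j < n | e i j && (i < j)%N) c i j * fbin K i j.

(* A minimal graded free resolution of the ideal J_G:
     ... --A 1--> F_1 --A 0--> F_0 --g--> J_G --> 0
   with F_i = (+)_{k < b i} S(-d i k) (basis element k of F_i has degree d i k),
   elements of F_i written as row vectors, F_(i+1) -> F_i being v |-> v *m A i.
   Graded: each generator g k is homogeneous of degree d 0 k, each entry
   (A i) r c is homogeneous of degree d (i+1) r - d i c.
   Minimal: every nonzero entry of A i has positive degree (lies in the
   homogeneous maximal ideal), i.e. d i c < d (i+1) r.
   Exact: g maps F_0 onto J_G, ker g = im (A 0), ker (A i) = im (A (i+1)). *)
Definition min_graded_free_resolution (K : fieldType) (n : nat) (e : rel 'I_n)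
  (b : nat -> nat) (d : forall i, 'I_(b i) -> nat)
  (g : 'I_(b 0%N) -> S K n) (A : forall i, 'M[S K n]_(b i.+1, b i)) : Prop :=
  [/\ (forall k, g k \is (d 0%N k).-homog),
      (forall i r c, (A i r c) \is (d i.+1 r - d i c)%N.-homog) &
      (forall i r c, A i r c != 0 -> (d i c < d i.+1 r)%N)] /\
  [/\
      (forall p : S K n, in_JG e p <-> (exists v : 'rV[S K n]_(b 0%N),
            p = \sum_(k < b 0%N) v 0 k * g k)),
      (forall v : 'rV[S K n]_(b 0%N),
         (\sum_(k < b 0%N) v 0 k * g k = 0) <->
         exists w : 'rV[S K n]_(b 1%N), v = w *m A 0%N) &
      (forall i (v : 'rV[S K n]_(b i.+1)),
         v *m A i = 0 <-> exists w : 'rV[S K n]_(b i.+2), v = w *m A i.+1)].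

(* reg(J_G) <= r : beta_{i,j}(J_G) <> 0 only if j - i <= r, where the graded
   Betti numbers are read off a minimal graded free resolution:
   beta_{i,j} = #{k < b i | d i k = j}. *)
Definition reg_JG_le (K : fieldType) (n : nat) (e : rel 'I_n) (r : int) : Prop :=
  exists b d g A, @min_graded_free_resolution K n e b d g A /\
    forall i (k : 'I_(b i)), ((d i k)%:Z - i%:Z <= r)%R.

(* Main.v *)
(** Regularity is tracked through syzygies: a graded submodule of a free module has
    regularity at most [r] when it is generated in degrees at most [r] by finitely many
    homogeneous elements whose syzygy module has regularity at most [r + 1].  By Schanuel's
    lemma this does not depend on the generators, which gives the usual estimates along
    short exact sequences and modulo a regular linear form.

    If [v] has two non-adjacent neighbours and [G_v] denotes [G] with the neighbourhood of
    [v] made a clique, then [J_G] is the intersection of [J_(G_v)] and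
    [J_(G - v) + (x_v, y_v)], and the sum of these two ideals is
    [J_(G_v - v) + (x_v, y_v)].  Since [G_v] contains a triangle, and [G_v - v] is a path
    only if [G] is one, induction reduces the theorem to disjoint unions of cliques.  There
    [x_m] is regular modulo [J_G], and [J_G + (x_m)] is again an intersection of two ideals
    attached to smaller graphs. *)
Require Import Defs.
From mathcomp Require Import all_boot all_order all_algebra.
From mathcomp Require Import perm ring zify.
From Stdlib Require Import Classical ClassicalEpsilon.
Set Implicit Arguments. Unset Strict Implicit. Unset Printing Implicit Defensive.
Import Order.TTheory GRing.Theory Num.Theory.
Local Open Scope ring_scope.

(** * Homogeneous polynomials *)

(** In the intersection sequence the sum of the two ideals must have regularity one less than the
    bound claimed for the intersection. To bound a non-path by its number of vertices minus one,
    [G_v - v] thus needs that number minus two, which its missing vertex gives only if it is not a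
    path; [G - v] may be a path, and its own number of vertices is enough. Hence the bounds for all
    graphs and for non-paths are proved in one induction.

    On a disjoint union of cliques [G_v] is [G], so the intersection says nothing and a regular
    element takes over. There each component with an edge uses at least two vertices and costs one
    unit of regularity, so [r] is a bound once there are fewer than [2 r] vertices.

    Deleted vertices stay as isolated ones, so vertices are counted in a set [W] containing all
    edges. Regularity is tested up to each finite depth [k]; only at the end are the stages
    assembled, by choosing minimal generators of one syzygy module after another. *)

Section Homogeneous.
Variables (K : fieldType) (N : nat).
Implicit Types (p q : {mpoly K[N]}) (a b c s : nat).

(* [p] has degree [b - a], or is zero when [b < a]: the condition for a coefficient
   sending a basis element of degree [b] to one of degree [a]. *)
Definition shomog a b p := forall u, u \in msupp p -> (mdeg u + a = b)%N.

Lemma shomogP a b p : shomog a b p <-> forall u, (mdeg u + a != b)%N -> p@_u = 0.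
Proof.
split=> [h u nu | h u].
  by apply/eqP; rewrite mcoeff_eq0; apply: contraNN nu => /h ->.
by rewrite mcoeff_msupp => /eqP; case: (eqVneq (mdeg u + a)%N b) => // /h.
Qed.

Lemma shomog0 a b : shomog a b 0.
Proof. by move=> u; rewrite msupp0. Qed.

Lemma shomogD a b p q : shomog a b p -> shomog a b q -> shomog a b (p + q).
Proof. by rewrite !shomogP => hp hq u nu; rewrite mcoeffD hp // hq // addr0. Qed.

Lemma shomogN a b p : shomog a b p -> shomog a b (- p).
Proof. by rewrite !shomogP => hp u nu; rewrite mcoeffN hp // oppr0. Qed.

Lemma shomogB a b p q : shomog a b p -> shomog a b q -> shomog a b (p - q).
Proof. by move=> hp hq; apply: shomogD => //; apply: shomogN. Qed.

Lemma shomog_sum a b (I : Type) (r : seq I) (P : pred I) (F : I -> {mpoly K[N]}) :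
  (forall i, P i -> shomog a b (F i)) -> shomog a b (\sum_(i <- r | P i) F i).
Proof. by move=> h; apply: big_ind => //; [exact: shomog0 | move=> x y; exact: shomogD]. Qed.

Lemma shomogM a b c p q : shomog a b p -> shomog b c q -> shomog a c (p * q).
Proof.
move=> hp hq u /msuppM_le /allpairsP[[u1 u2] /= [/hp h1 /hq h2 ->]].
by rewrite mdegD -h2 -h1; lia.
Qed.

Lemma shomog1 a : shomog a a 1.
Proof. by move=> u; rewrite msupp1 inE => /eqP ->; rewrite mdeg0. Qed.

Lemma shomogX a i : shomog a a.+1 'X_i.
Proof. by move=> u; rewrite msuppX inE => /eqP ->; rewrite mdeg1. Qed.

Lemma shomogS a b p : shomog a b p -> shomog a.+1 b.+1 p.
Proof. by move=> h u /h <-; rewrite addnS. Qed.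

(** The degree [s] part of [p] taken as a coordinate at a basis element of degree [a]: its part of
    polynomial degree [s - a], or zero when [s < a]. *)
Definition hcomp a s p : {mpoly K[N]} :=
  \sum_(u <- msupp p | (mdeg u + a == s)%N) p@_u *: 'X_[u].

Lemma mcoeff_hcomp a s p u :
  (hcomp a s p)@_u = if (mdeg u + a == s)%N then p@_u else 0.
Proof.
rewrite /hcomp raddf_sum /=.
under eq_bigr => v _ do rewrite mcoeffZ mcoeffX.
case: (boolP (u \in msupp p)) => hu; last first.
  rewrite (memN_msupp_eq0 hu) if_same big_seq_cond big1 // => v /andP[hv _].
  by case: eqP => [E|_]; rewrite ?mulr0 //; rewrite E (negPf hu) in hv.
case: ifP => hs.
  rewrite big_mkcond (bigD1_seq u) //= hs eqxx mulr1 big1 ?addr0 // => v /negPf ->.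
  by rewrite mulr0 if_same.
rewrite big1 // => v hv; case: eqP => [E|_]; rewrite ?mulr0 //.
by rewrite -E hv in hs.
Qed.

Lemma hcomp_homog a s p : shomog a s (hcomp a s p).
Proof. by apply/shomogP => u /negPf h; rewrite mcoeff_hcomp h. Qed.

Lemma hcomp_id a s p : shomog a s p -> hcomp a s p = p.
Proof.
move=> /shomogP h; apply/mpolyP => u; rewrite mcoeff_hcomp; case: ifP => // /negbT nu.
by rewrite h.
Qed.

Lemma hcompD a s p q : hcomp a s (p + q) = hcomp a s p + hcomp a s q.
Proof.
apply/mpolyP => u; rewrite mcoeffD !mcoeff_hcomp mcoeffD.
by case: ifP; rewrite ?addr0.
Qed.

Lemma hcomp0 a s : hcomp a s 0 = 0.
Proof. by rewrite hcomp_id //; exact: shomog0. Qed.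

Lemma hcomp_sum a s (I : Type) (r : seq I) (P : pred I) (F : I -> {mpoly K[N]}) :
  hcomp a s (\sum_(i <- r | P i) F i) = \sum_(i <- r | P i) hcomp a s (F i).
Proof. by apply: (big_morph _ (hcompD a s) (hcomp0 a s)). Qed.

(** What remains of [p] without its component has no monomial that the homogeneous [q] could bring
    to degree [s]. *)
Lemma hcompM a b s p q : shomog a b q -> hcomp a s (p * q) = hcomp b s p * q.
Proof.
move=> hq; rewrite -{1}(subrK (hcomp b s p) p) mulrDl hcompD.
rewrite (@hcomp_id _ _ (hcomp b s p * q)); last first.
  by rewrite mulrC; apply: shomogM hq _; exact: hcomp_homog.
rewrite -[RHS]add0r; congr (_ + _); apply/mpolyP => u.
rewrite mcoeff_hcomp mcoeff0; case: eqP => // hu; apply/eqP.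
rewrite mcoeff_eq0; apply/negP => /msuppM_le /allpairsP[[u1 u2] /= [h1 /hq h2 e]].
move: h1; rewrite mcoeff_msupp mcoeffB mcoeff_hcomp; case: (_ + b =P s)%N => [_|].
  by rewrite subrr eqxx.
by case; rewrite -h2 -hu e mdegD; lia.
Qed.

Lemma hcomp_sumE a p B :
  (msize p + a <= B)%N -> p = \sum_(s < B) hcomp a s p.
Proof.
move=> hB; apply/mpolyP => u; rewrite raddf_sum /=.
under eq_bigr => s _ do rewrite mcoeff_hcomp.
case: (boolP (u \in msupp p)) => hu; last first.
  by rewrite (memN_msupp_eq0 hu) big1 // => i _; rewrite if_same.
have hs : (mdeg u + a < B)%N.
  by apply: leq_trans hB; rewrite ltn_add2r msize_mdeg_lt.
rewrite (bigD1 (Ordinal hs)) //= eqxx big1 ?addr0 // => i hi.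
by rewrite ifF //; apply: contra_neqF hi => /eqP e; apply: val_inj.
Qed.

Lemma hcompS0 a p : hcomp a.+1 0 p = 0.
Proof. by apply/mpolyP => u; rewrite mcoeff_hcomp addnS mcoeff0. Qed.

Lemma hcompSS a s p : hcomp a.+1 s.+1 p = hcomp a s p.
Proof. by apply/mpolyP => u; rewrite !mcoeff_hcomp addnS eqSS. Qed.

End Homogeneous.

(** * Graded free modules *)

Section GradedMatrices.
Variables (K : fieldType) (N : nat).
Local Notation R := {mpoly K[N]}.

(* [d j] and [dd i] are the degrees of the basis elements of the target and of the
   source of the map [v |-> v *m g]. *)
Definition mxhomog t m (dd : 'I_t -> nat) (d : 'I_m -> nat) (g : 'M[R]_(t, m)) :=
  forall i j, shomog (d j) (dd i) (g i j).

Definition dsum t1 t2 (d1 : 'I_t1 -> nat) (d2 : 'I_t2 -> nat) (i : 'I_(t1 + t2)) :=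
  match split i with inl j => d1 j | inr j => d2 j end.

Lemma dsum_le t1 t2 (d1 : 'I_t1 -> nat) (d2 : 'I_t2 -> nat) r :
  (forall i, d1 i <= r)%N -> (forall i, d2 i <= r)%N -> forall i, (dsum d1 d2 i <= r)%N.
Proof. by move=> h1 h2 i; rewrite /dsum; case: split. Qed.

Lemma mxhomog_col t1 t2 m (d1 : 'I_t1 -> nat) (d2 : 'I_t2 -> nat) (d : 'I_m -> nat) g1 g2 :
  mxhomog d1 d g1 -> mxhomog d2 d g2 -> mxhomog (dsum d1 d2) d (col_mx g1 g2).
Proof. by move=> h1 h2 i j; rewrite /dsum mxE; case: split => k. Qed.

Lemma mxhomog_row t m1 m2 (dd : 'I_t -> nat) (d1 : 'I_m1 -> nat) (d2 : 'I_m2 -> nat) g1 g2 :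
  mxhomog dd d1 g1 -> mxhomog dd d2 g2 -> mxhomog dd (dsum d1 d2) (row_mx g1 g2).
Proof. by move=> h1 h2 i j; rewrite /dsum mxE; case: split => k. Qed.

Lemma mxhomog0 t m (dd : 'I_t -> nat) (d : 'I_m -> nat) : mxhomog dd d 0.
Proof. by move=> i j; rewrite mxE; exact: shomog0. Qed.

Lemma mxhomog1 m (d : 'I_m -> nat) : mxhomog d d 1%:M.
Proof.
by move=> i j; rewrite mxE; case: eqP => [->|_]; [exact: shomog1 | exact: shomog0].
Qed.

Lemma mxhomog_scalar m (d : 'I_m -> nat) l :
  (forall a, shomog a a.+1 l) -> mxhomog (fun i => (d i).+1) d l%:M.
Proof.
by move=> hl i j; rewrite mxE; case: eqP => [->|_]; [exact: hl | exact: shomog0].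
Qed.

Lemma mxhomogN t m (dd : 'I_t -> nat) (d : 'I_m -> nat) g : mxhomog dd d g -> mxhomog dd d (- g).
Proof. by move=> h i j; rewrite mxE; apply: shomogN. Qed.

Lemma mxhomogB t m (dd : 'I_t -> nat) (d : 'I_m -> nat) g h :
  mxhomog dd d g -> mxhomog dd d h -> mxhomog dd d (g - h).
Proof. by move=> shomog' hh i j; rewrite !mxE; apply: shomogB. Qed.

Lemma mxhomog_mul t m p (dt : 'I_t -> nat) (dm : 'I_m -> nat) (dp : 'I_p -> nat) g h :
  mxhomog dt dm g -> mxhomog dm dp h -> mxhomog dt dp (g *m h).
Proof.
move=> shomog' hh i j; rewrite mxE; apply: shomog_sum => k _.
by rewrite mulrC; apply: shomogM (hh k j) (shomog' i k).
Qed.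

Definition rvhomog m (d : 'I_m -> nat) s (v : 'rV[R]_m) := mxhomog (fun=> s) d v.

Definition rvcomp m (d : 'I_m -> nat) s (v : 'rV[R]_m) : 'rV[R]_m :=
  \row_j hcomp (d j) s (v 0 j).

Lemma rvcomp_homog m (d : 'I_m -> nat) s v : rvhomog d s (rvcomp d s v).
Proof. by move=> i j; rewrite mxE; exact: hcomp_homog. Qed.

Lemma rvcomp_id m (d : 'I_m -> nat) s v : rvhomog d s v -> rvcomp d s v = v.
Proof. by move=> h; apply/rowP => j; rewrite mxE hcomp_id. Qed.

Lemma rvcomp_mul t m (dd : 'I_t -> nat) (d : 'I_m -> nat) s g a :
  mxhomog dd d g -> rvcomp d s (a *m g) = rvcomp dd s a *m g.
Proof.
move=> h; apply/rowP => j; rewrite !mxE hcomp_sum; apply: eq_bigr => k _.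
by rewrite mxE; apply: hcompM.
Qed.

Lemma rvcompD m (d : 'I_m -> nat) s u v : rvcomp d s (u + v) = rvcomp d s u + rvcomp d s v.
Proof. by apply/rowP => j; rewrite !mxE hcompD. Qed.

Lemma rvcomp0 m (d : 'I_m -> nat) s : rvcomp d s 0 = 0.
Proof. by apply/rowP => j; rewrite !mxE hcomp0. Qed.

Lemma rvcomp_sumE m (d : 'I_m -> nat) v : exists B, v = \sum_(s < B) rvcomp d s v.
Proof.
exists (\max_j (msize (v 0%R j) + d j))%N; apply/rowP => j; rewrite summxE.
rewrite (eq_bigr (fun s : 'I__ => hcomp (d j) s (v 0 j))) => [|s _]; last by rewrite mxE.
by apply: hcomp_sumE; rewrite (leq_bigmax (F := fun j => (msize (v 0%R j) + d j)%N)).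
Qed.

Record graded m (d : 'I_m -> nat) (M : 'rV[R]_m -> Prop) : Prop := Graded {
  graded0 : M 0;
  gradedD : forall u v, M u -> M v -> M (u + v);
  gradedZ : forall c v, M v -> M (c *: v);
  gradedC : forall s v, M v -> M (rvcomp d s v) }.

Lemma gradedN m d (M : 'rV[R]_m -> Prop) v : graded d M -> M v -> M (- v).
Proof. by move=> h Mv; rewrite -scaleN1r; apply: (gradedZ h). Qed.

Lemma gradedB m d (M : 'rV[R]_m -> Prop) u v : graded d M -> M u -> M v -> M (u - v).
Proof. by move=> h Mu Mv; apply: (gradedD h) => //; apply: gradedN h Mv. Qed.

Lemma graded_sum m d (M : 'rV[R]_m -> Prop) (I : Type) (r : seq I) (P : pred I) F :
  graded d M -> (forall i, P i -> M (F i)) -> M (\sum_(i <- r | P i) F i).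
Proof.
move=> h hF; apply: big_ind => //; [exact: graded0 h | exact: gradedD h].
Qed.

Lemma graded_mul m d (M : 'rV[R]_m -> Prop) t (g : 'M[R]_(t, m)) a :
  graded d M -> (forall i, M (row i g)) -> M (a *m g).
Proof.
by move=> h hF; rewrite mulmx_sum_row; apply: (graded_sum _ h) => i _; apply: (gradedZ h).
Qed.

Lemma graded_syz t m (dd : 'I_t -> nat) (d : 'I_m -> nat) g :
  mxhomog dd d g -> graded dd (fun a => a *m g = 0).
Proof.
move=> shomog'; split=> [|u v hu hv|c v hv|s v hv].
- by rewrite mul0mx.
- by rewrite mulmxDl hu hv addr0.
- by rewrite -scalemxAl hv scaler0.
- by rewrite -(rvcomp_mul _ _ shomog') hv rvcomp0.
Qed.

(** Any preimage of a homogeneous element may be replaced by its component of the same degree, since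
    [phi] preserves degrees and [B] is graded. *)
Lemma graded_lift m p t (d : 'I_m -> nat) (dp : 'I_p -> nat) (dd : 'I_t -> nat)
    (B : 'rV[R]_m -> Prop) (phi : 'M_(m, p)) (g : 'M_(t, p)) :
  graded d B -> mxhomog d dp phi -> mxhomog dd dp g ->
  (forall i, exists b, B b /\ row i g = b *m phi) ->
  exists L : 'M_(t, m), [/\ mxhomog dd d L, (forall i, B (row i L)) & L *m phi = g].
Proof.
move=> hB hphi hgg hL.
have /fin_all_exists[L hL'] : forall i : 'I_t, exists b,
    [/\ rvhomog d (dd i) b, B b & row i g = b *m phi].
  move=> i; have [b [Bb e]] := hL i; exists (rvcomp d (dd i) b); split.
  - exact: rvcomp_homog.
  - exact: (gradedC hB).
  - by rewrite -(rvcomp_mul _ _ hphi) -e rvcomp_id // => k j; rewrite mxE; exact: hgg.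
exists (\matrix_i L i); split.
- by move=> i j; rewrite mxE; case: (hL' i) => h _ _; apply: h.
- by move=> i; rewrite rowK; case: (hL' i).
- by apply/row_matrixP => i; rewrite row_mul rowK; case: (hL' i).
Qed.

End GradedMatrices.

(** * Regularity and short exact sequences *)

Section Regularity.
Variables (K : fieldType) (N : nat).
Local Notation R := {mpoly K[N]}.

(* The first [k] steps of a free resolution witness that the submodule [M] of the free
   module with basis degrees [d] has regularity at most [r]. *)
Fixpoint reg_upto k m (d : 'I_m -> nat) (M : 'rV[R]_m -> Prop) (r : nat) : Prop :=
  if k is k'.+1 then
    exists t (dd : 'I_t -> nat) (g : 'M[R]_(t, m)),
      [/\ mxhomog dd d g, forall i, (dd i <= r)%N,
          forall v, M v <-> exists a, v = a *m g
        & reg_upto k' dd (fun a => a *m g = 0) r.+1]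
  else True.

Definition kerM m p (B : 'rV[R]_m -> Prop) (phi : 'M[R]_(m, p)) b := B b /\ b *m phi = 0.
Definition imM m p (B : 'rV[R]_m -> Prop) (phi : 'M[R]_(m, p)) c :=
  exists b, B b /\ c = b *m phi.

Lemma mul_inr t1 t2 (u : 'rV[R]_(t1 + t2)) : u *m col_mx 0 1%:M = rsubmx u.
Proof. by rewrite -{1}(hsubmxK u) mul_row_col mulmx0 add0r mulmx1. Qed.

Lemma mul_inl t1 t2 (u : 'rV[R]_(t1 + t2)) : u *m col_mx 1%:M 0 = lsubmx u.
Proof. by rewrite -{1}(hsubmxK u) mul_row_col mulmx0 addr0 mulmx1. Qed.

Lemma mul_col t1 t2 m (u : 'rV[R]_(t1 + t2)) (g1 : 'M_(t1, m)) (g2 : 'M_(t2, m)) :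
  u *m col_mx g1 g2 = lsubmx u *m g1 + rsubmx u *m g2.
Proof. by rewrite -{1}(hsubmxK u) mul_row_col. Qed.

Lemma mxhomog_inr t1 t2 (d1 : 'I_t1 -> nat) (d2 : 'I_t2 -> nat) :
  mxhomog (dsum d1 d2) d2 (col_mx 0 1%:M : 'M[R]_(_, _)).
Proof. by apply: mxhomog_col; [exact: mxhomog0 | exact: mxhomog1]. Qed.

Lemma mxhomog_inl t1 t2 (d1 : 'I_t1 -> nat) (d2 : 'I_t2 -> nat) :
  mxhomog (dsum d1 d2) d1 (col_mx 1%:M 0 : 'M[R]_(_, _)).
Proof. by apply: mxhomog_col; [exact: mxhomog1 | exact: mxhomog0]. Qed.

Lemma gen_row t m (M : 'rV[R]_m -> Prop) (g : 'M[R]_(t, m)) i :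
  (forall v, M v <-> exists a, v = a *m g) -> M (row i g).
Proof. by move=> h; apply/h; exists (delta_mx 0 i); rewrite rowE. Qed.

Lemma reg_upto_ext k m (d : 'I_m -> nat) M M' r :
  (forall v, M v <-> M' v) -> reg_upto k d M r -> reg_upto k d M' r.
Proof.
case: k => // k e [t [dd [g [h1 h2 h3 h4]]]].
by exists t, dd, g; split=> // v; rewrite -e.
Qed.

Lemma reg_upto_mono k m (d : 'I_m -> nat) M r r' : (r <= r')%N -> reg_upto k d M r -> reg_upto k d M r'.
Proof.
elim: k m d M r r' => // k IH m d M r r' hr [t [dd [g [h1 h2 h3 h4]]]].
exists t, dd, g; split=> //; first by move=> i; apply: leq_trans (h2 i) hr.
exact: IH h4.
Qed.

Lemma reg_upto_shift k m (d : 'I_m -> nat) M r :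
  reg_upto k d M r -> reg_upto k (fun i => (d i).+1) M r.+1.
Proof.
elim: k m d M r => // k IH m d M r [t [dd [g [h1 h2 h3 h4]]]].
exists t, (fun i => (dd i).+1), g; split=> //; last exact: IH.
by move=> i j; apply: shomogS.
Qed.

Lemma reg_upto_iso k m p (d : 'I_m -> nat) (dp : 'I_p -> nat) (psi : 'M_(m, p)) M r :
  mxhomog d dp psi -> (forall v, M v -> v *m psi = 0 -> v = 0) ->
  reg_upto k d M r -> reg_upto k dp (imM M psi) r.
Proof.
case: k => // k hpsi inj [t [dd [g [h1 h2 h3 h4]]]].
exists t, dd, (g *m psi); split=> //.
- exact: mxhomog_mul h1 hpsi.
- move=> v; split=> [[b [/h3[a ->] ->]] | [a ->]].
    by exists a; rewrite mulmxA.
  by exists (a *m g); split; [apply/h3; exists a | rewrite mulmxA].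
- apply: reg_upto_ext h4 => a; rewrite mulmxA; split=> [->|]; first by rewrite mul0mx.
  by apply: inj; apply/h3; exists a.
Qed.

Lemma reg_upto_inl k t1 t2 (d1 : 'I_t1 -> nat) (d2 : 'I_t2 -> nat) M r :
  reg_upto k d1 M r -> reg_upto k (dsum d1 d2) (fun v => M (lsubmx v) /\ rsubmx v = 0) r.
Proof.
have e1 (v : 'rV[R]_t1) : v *m row_mx 1%:M (0 : 'M_(_, t2)) = row_mx v 0.
  by rewrite mul_mx_row mulmx0 mulmx1.
have h1 : mxhomog d1 (dsum d1 d2) (row_mx 1%:M 0 : 'M[R]_(_, _)).
  by apply: mxhomog_row; [exact: mxhomog1 | exact: mxhomog0].
move=> hM; apply: reg_upto_ext (reg_upto_iso h1 _ hM) => [v|v _]; last first.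
  by rewrite e1 => /(congr1 lsubmx); rewrite row_mxKl raddf0.
split=> [[b [Mb ->]]|[Mv ev]]; first by rewrite e1 row_mxKl row_mxKr.
by exists (lsubmx v); rewrite e1 -ev hsubmxK.
Qed.

Lemma reg_upto_zero k m (d : 'I_m -> nat) r : reg_upto k d (fun v => v = 0) r.
Proof.
elim: k m d r => // k IH m d r.
exists 0%N, (fun=> 0%N), 0; split=> // [[]//|v|].
  by split=> [->|[a ->]]; [exists 0; rewrite mul0mx | rewrite mulmx0].
apply: reg_upto_ext (IH 0%N _ _) => v; rewrite mulmx0; split=> // _.
by apply/rowP; case.
Qed.

Lemma reg_upto_free k m (d : 'I_m -> nat) r :
  (forall i, (d i <= r)%N) -> reg_upto k d (fun=> True) r.
Proof.
case: k => // k hd; exists m, d, 1%:M; split=> //; first exact: mxhomog1.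
  by move=> v; split=> // _; exists v; rewrite mulmx1.
by apply: reg_upto_ext (reg_upto_zero k d r.+1) => v; rewrite mulmx1.
Qed.

(** Generators of the kernel and lifts of generators of the image generate [B]. Forgetting the first
    block maps their syzygies onto those of [g2], with kernel those of [g1], so the induction on the
    depth applies to them. *)
Lemma horseshoe k m p (d : 'I_m -> nat) (dp : 'I_p -> nat) B (phi : 'M_(m, p)) r :
  graded d B -> mxhomog d dp phi ->
  reg_upto k d (kerM B phi) r -> reg_upto k dp (imM B phi) r -> reg_upto k d B r.
Proof.
elim: k m p d dp B phi r => // k IH m p d dp B phi r hB hphi.
move=> [t1 [d1 [g1 [h1 h2 h3 h4]]]] [t2 [d2 [g2 [k1 k2 k3 k4]]]].
have [L [hL BL eL]] := graded_lift hB hphi k1 (fun i => gen_row i k3).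
have Bg1 i : B (row i g1) by case: (gen_row i h3).
have g10 : g1 *m phi = 0.
  by apply/row_matrixP => i; rewrite row_mul row0; case: (gen_row i h3).
exists (t1 + t2)%N, (dsum d1 d2), (col_mx g1 L); split.
- exact: mxhomog_col.
- exact: dsum_le.
- move=> v; split=> [Bv|[a ->]]; last first.
    rewrite -(hsubmxK a) mul_row_col.
    by apply: (gradedD hB); apply: graded_mul hB _.
  have [c ec] : exists c, v *m phi = c *m g2 by apply/k3; exists v.
  have [a ea] : exists a, v - c *m L = a *m g1.
    apply/h3; split; first by apply: (gradedB hB) => //; apply: graded_mul hB _.
    by rewrite mulmxBl ec -mulmxA eL subrr.
  by exists (row_mx a c); rewrite mul_row_col -ea subrK.
- apply: (IH _ _ _ d2 _ (col_mx 0 1%:M)).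
  + by apply: graded_syz (mxhomog_col h1 hL).
  + exact: mxhomog_inr.
  + apply: reg_upto_ext (reg_upto_inl d2 h4) => v; rewrite /kerM mul_inr mul_col.
    by split=> -[e1 e2]; split=> //; move: e1; rewrite e2 mul0mx addr0.
  + apply: reg_upto_ext k4 => c; split=> [ec|[b [eb ->]]]; last first.
      rewrite mul_inr -eL mulmxA; move: eb; rewrite -{1}(hsubmxK b) mul_row_col.
      move/eqP; rewrite addrC addr_eq0 => /eqP ->.
      by rewrite mulNmx -mulmxA g10 mulmx0 oppr0.
    have [a ea] : exists a, c *m L = a *m g1.
      apply/h3; split; first exact: graded_mul hB _.
      by rewrite -mulmxA eL.
    exists (row_mx (- a) c); rewrite mul_inr row_mxKr; split=> //.
    by rewrite mul_row_col ea mulNmx addNr.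
Qed.

(** The generators of [B] also generate the image. Their syzygies there map by [g] onto the kernel
    of [phi], with kernel the syzygies in [B]; the kernel of [phi] thus enters one step up, where
    [r.+1] is allowed. *)
Lemma reg_upto_quot k m p (d : 'I_m -> nat) (dp : 'I_p -> nat) B (phi : 'M_(m, p)) r :
  graded d B -> mxhomog d dp phi ->
  reg_upto k.+1 d B r -> reg_upto k d (kerM B phi) r.+1 -> reg_upto k.+1 dp (imM B phi) r.
Proof.
move=> hB hphi [t [dd [g [h1 h2 h3 h4]]]] hk.
exists t, dd, (g *m phi); split=> //.
- exact: mxhomog_mul h1 hphi.
- move=> v; split=> [[b [/h3[a ->] ->]]|[a ->]]; first by exists a; rewrite mulmxA.
  by exists (a *m g); split; [apply/h3; exists a | rewrite mulmxA].
- apply: (horseshoe (graded_syz (mxhomog_mul h1 hphi)) h1).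
    apply: reg_upto_ext h4 => v; rewrite /kerM; split=> [e|[]//].
    by rewrite mulmxA e mul0mx.
  apply: reg_upto_ext hk => v; rewrite /kerM /imM; split.
    by move=> [/h3[a ->] e]; exists a; rewrite mulmxA.
  move=> [b [e ->]]; rewrite -mulmxA; split=> //; by apply/h3; exists b.
Qed.

(** A surjection onto a free module splits. The projector [P] attached to a homogeneous section [S]
    carries generators of [B] to generators of the kernel. This extends their syzygies by the free
    module, whose degrees may reach [r.+1] because it sits one step up. *)
Lemma reg_upto_summand k m p (d : 'I_m -> nat) (dp : 'I_p -> nat) B (phi : 'M_(m, p)) r :
  graded d B -> mxhomog d dp phi -> (forall c, imM B phi c) -> (forall i, dp i <= r.+1)%N ->
  reg_upto k d B r -> reg_upto k d (kerM B phi) r.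
Proof.
case: k => // k hB hphi surj hdp [t [dd [g [h1 h2 h3 h4]]]].
have [S [hS BS eS]] := graded_lift hB hphi (@mxhomog1 K N p dp) (fun i => surj (row i 1%:M)).
pose P := 1%:M - phi *m S.
have ephi : P *m phi = 0 by rewrite mulmxBl mul1mx -mulmxA eS mulmx1 subrr.
have Pid v : v *m phi = 0 -> v *m P = v.
  by move=> e; rewrite mulmxBr mulmx1 mulmxA e mul0mx subr0.
have hP : mxhomog d d P by apply: mxhomogB; [exact: mxhomog1 | exact: mxhomog_mul hphi hS].
have BP v : B v -> B (v *m P).
  move=> Bv; rewrite mulmxBr mulmx1 mulmxA; apply: (gradedB hB) => //.
  exact: graded_mul hB _.
exists t, dd, (g *m P); split=> //.
- exact: mxhomog_mul h1 hP.
- move=> v; split=> [[/h3[a ea] e]|[a ->]].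
    by exists a; rewrite mulmxA -ea Pid.
  rewrite mulmxA; split; last by rewrite -mulmxA ephi mulmx0.
  by apply: BP; apply/h3; exists a.
- have shomogP := mxhomog_mul h1 hP.
  apply: (horseshoe (graded_syz shomogP) (mxhomog_mul h1 hphi)).
    apply: reg_upto_ext h4 => v; rewrite /kerM !mulmxA; split=> [->|[e1 e2]].
      by rewrite !mul0mx.
    by rewrite -[LHS]Pid.
  apply: reg_upto_ext (reg_upto_free k hdp) => c; split=> // _.
  have [b eb] : exists b, c *m S = b *m g by apply/h3; apply: graded_mul hB _.
  exists b; rewrite !mulmxA -eb; split; last by rewrite -mulmxA eS mulmx1.
  by rewrite mulmxBr mulmx1 mulmxA -(mulmxA c) eS mulmx1 subrr.
Qed.

(* Schanuel's lemma: both syzygy modules are compared with the pullback of the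
   two presentations. *)
Lemma reg_upto_indep k m (d : 'I_m -> nat) M r t (dd : 'I_t -> nat) (g : 'M_(t, m)) :
  reg_upto k.+1 d M r -> mxhomog dd d g -> (forall i, dd i <= r.+1)%N ->
  (forall v, M v <-> exists a, v = a *m g) -> reg_upto k dd (fun a => a *m g = 0) r.+1.
Proof.
move=> [t0 [d0 [g0 [h1 h2 h3 h4]]]] shomog' hd hM.
pose P (u : 'rV[R]_(t0 + t)) := u *m col_mx g0 (- g) = 0.
have hP : graded (dsum d0 dd) P by apply: graded_syz (mxhomog_col h1 (mxhomogN shomog')).
have eP u : P u <-> lsubmx u *m g0 = rsubmx u *m g.
  rewrite /P -{1}(hsubmxK u) mul_row_col mulmxN.
  by split=> [/eqP|->]; rewrite ?subrr // subr_eq0 => /eqP.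
(* The pullback maps onto the free module on [dd] with kernel the syzygies of [g0]. *)
have GP : reg_upto k (dsum d0 dd) P r.+1.
  apply: (horseshoe hP (mxhomog_inr d0 dd)).
    apply: reg_upto_ext (reg_upto_inl dd h4) => v; rewrite /kerM mul_inr.
    split=> [[e1 e2]|[/eP e1 e2]]; last by rewrite e1 e2 mul0mx.
    by split=> //; apply/eP; rewrite e1 e2 mul0mx.
  apply: reg_upto_ext (reg_upto_free k hd) => c; split=> // _.
  have [b eb] : exists b, c *m g = b *m g0 by apply/h3/hM; exists c.
  by exists (row_mx b c); rewrite mul_inr row_mxKr; split=> //; apply/eP;
     rewrite row_mxKl row_mxKr.
(* Projected the other way, it maps onto the free module on [d0] with kernel the syzygies of [g]. *)
have h := reg_upto_summand hP (mxhomog_inl d0 dd) _ _ GP.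
have {}h : reg_upto k (dsum d0 dd) (kerM P (col_mx 1%:M 0)) r.+1.
  apply: h => [c|i]; last by apply: leq_trans (h2 i) _; lia.
  have [b eb] : exists b, c *m g0 = b *m g by apply/hM/h3; exists c.
  by exists (row_mx c b); rewrite mul_inl row_mxKl; split=> //; apply/eP;
     rewrite row_mxKl row_mxKr.
have := @reg_upto_iso k _ _ _ dd (col_mx 0 1%:M) _ _ (mxhomog_inr d0 dd) _ h.
move=> {}h; apply: reg_upto_ext (h _) => [v|v [_]]; last first.
  by rewrite mul_inl mul_inr -{3}(hsubmxK v) => -> ->; rewrite row_mx0.
rewrite /kerM; split=> [[b [[/eP e1]]]|e].
  by rewrite mul_inl mul_inr => e2 ->; rewrite -e1 e2 mul0mx.
exists (row_mx 0 v); rewrite mul_inl mul_inr row_mxKl row_mxKr; split=> //.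
by split=> //; apply/eP; rewrite row_mxKl row_mxKr mul0mx e.
Qed.

(** The generators of [B] also generate the image, and [reg_upto_indep] bounds their syzygies there
    by [r.+1] although their degrees may exceed [r]. These syzygies map onto the kernel of [phi],
    with kernel the syzygies in [B]. *)
Lemma reg_upto_ker k m p (d : 'I_m -> nat) (dp : 'I_p -> nat) B (phi : 'M_(m, p)) r :
  graded d B -> mxhomog d dp phi ->
  reg_upto k d B r.+1 -> reg_upto k.+1 dp (imM B phi) r -> reg_upto k d (kerM B phi) r.+1.
Proof.
case: k => // k hB hphi [t [dd [g [h1 h2 h3 h4]]]] him.
have := reg_upto_indep him (mxhomog_mul h1 hphi) h2.
have egen v : imM B phi v <-> exists a, v = a *m (g *m phi).
  split=> [[b [/h3[a ->] ->]]|[a ->]]; first by exists a; rewrite mulmxA.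
  by exists (a *m g); split; [apply/h3; exists a | rewrite mulmxA].
move=> /(_ egen) hK.
have hsK := graded_syz (mxhomog_mul h1 hphi).
have := reg_upto_quot hsK h1 hK; move=> h.
apply: reg_upto_ext (h _) => [v|].
  rewrite /imM /kerM; split=> [[b [e ->]]|[/h3[a ->] e]]; last first.
    by exists a; rewrite mulmxA.
  by rewrite -mulmxA; split=> //; apply/h3; exists b.
apply: reg_upto_ext h4 => v; rewrite /kerM mulmxA; split=> [->|[]//].
by rewrite mul0mx.
Qed.

End Regularity.

(** * Intersections, and reduction modulo a regular linear form *)

Section RegularElements.
Variables (K : fieldType) (N : nat).
Local Notation R := {mpoly K[N]}.

Definition prodM m1 m2 (M1 : 'rV[R]_m1 -> Prop) (M2 : 'rV[R]_m2 -> Prop)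
  (w : 'rV[R]_(m1 + m2)) := M1 (lsubmx w) /\ M2 (rsubmx w).

Lemma graded_prod m1 m2 (d1 : 'I_m1 -> nat) (d2 : 'I_m2 -> nat) M1 M2 :
  graded d1 M1 -> graded d2 M2 -> graded (dsum d1 d2) (@prodM m1 m2 M1 M2).
Proof.
move=> h1 h2; have el s v : lsubmx (rvcomp (dsum d1 d2) s v) = rvcomp d1 s (lsubmx v).
  by apply/rowP => j; rewrite !mxE /dsum (unsplitK (inl j)).
have er s v : rsubmx (rvcomp (dsum d1 d2) s v) = rvcomp d2 s (rsubmx v).
  by apply/rowP => j; rewrite !mxE /dsum (unsplitK (inr j)).
split=> [|u v [u1 u2] [v1 v2]|c v [v1 v2]|s v [v1 v2]]; rewrite /prodM.
- by rewrite !raddf0; split; [exact: graded0 h1 | exact: graded0 h2].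
- by rewrite !raddfD; split; [exact: (gradedD h1) | exact: (gradedD h2)].
- by rewrite !linearZ; split; [exact: (gradedZ h1) | exact: (gradedZ h2)].
- by rewrite el er; split; [exact: (gradedC h1) | exact: (gradedC h2)].
Qed.

Lemma reg_upto_prod k m1 m2 (d1 : 'I_m1 -> nat) (d2 : 'I_m2 -> nat) M1 M2 r :
  graded d1 M1 -> graded d2 M2 -> reg_upto k d1 M1 r -> reg_upto k d2 M2 r ->
  reg_upto k (dsum d1 d2) (@prodM m1 m2 M1 M2) r.
Proof.
move=> s1 s2 g1 g2; apply: (horseshoe (graded_prod s1 s2) (mxhomog_inr d1 d2)).
  apply: reg_upto_ext (reg_upto_inl d2 g1) => v; rewrite /kerM /prodM mul_inr.
  by split=> [[e1 e2]|[[e1 _] e2]]; rewrite ?e2; do !split=> //; exact: graded0 s2.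
apply: reg_upto_ext g2 => v; split=> [Mv|[b [[_ h] ->]]]; last by rewrite mul_inr.
exists (row_mx 0 v); rewrite mul_inr /prodM row_mxKl row_mxKr; do !split=> //.
exact: graded0 s1.
Qed.

(** The intersection is the kernel of addition from the product onto the sum, embedded by [v] to
    [(v, -v)]. *)
Lemma reg_upto_cap k m (d : 'I_m -> nat) M1 M2 r :
  graded d M1 -> graded d M2 -> reg_upto k d M1 r.+1 -> reg_upto k d M2 r.+1 ->
  reg_upto k.+1 d (fun v : 'rV[R]_m => exists u1 u2, [/\ M1 u1, M2 u2 & v = u1 + u2]) r ->
  reg_upto k d (fun v => M1 v /\ M2 v) r.+1.
Proof.
move=> s1 s2 g1 g2 hsum.
have hphi : mxhomog (dsum d d) d (col_mx 1%:M 1%:M : 'M[R]_(_, _)).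
  by apply: mxhomog_col; exact: mxhomog1.
have ephi (v : 'rV[R]_(m + m)) : v *m col_mx 1%:M 1%:M = lsubmx v + rsubmx v.
  by rewrite -{1}(hsubmxK v) mul_row_col !mulmx1.
have := reg_upto_ker (graded_prod s1 s2) hphi (reg_upto_prod s1 s2 g1 g2).
move=> /(_ _) h; have {h}h : reg_upto k (dsum d d) (kerM (prodM M1 M2) (col_mx 1%:M 1%:M)) r.+1.
  apply: h; apply: reg_upto_ext hsum => v; split=> [[u1 [u2 [h1 h2 ->]]]|[b [[h1 h2] ->]]].
    exists (row_mx u1 u2); rewrite ephi row_mxKl row_mxKr /prodM.
    by rewrite row_mxKl row_mxKr.
  by rewrite ephi; exists (lsubmx b), (rsubmx b).
apply: reg_upto_ext (reg_upto_iso (mxhomog_inl d d) _ h) => [v|v [_]]; last first.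
  by rewrite ephi mul_inl -{4}(hsubmxK v) => e1 e2; move: e1; rewrite e2 add0r => ->;
     rewrite row_mx0.
split=> [[b [[[h1 h2] e] ->]]|[h1 h2]].
  move: e; rewrite ephi mul_inl => /eqP; rewrite addr_eq0 => /eqP e.
  by split=> //; rewrite e; apply: gradedN s2 _.
exists (row_mx v (- v)); rewrite mul_inl row_mxKl /kerM ephi /prodM.
by rewrite row_mxKl row_mxKr subrr; do !split=> //; apply: gradedN s2 _.
Qed.

Definition addM m (M : 'rV[R]_m -> Prop) (l : R) w := exists u v, M u /\ w = u + l *: v.

(** With [F] the ambient free module, [M + l F] is the quotient of [M x F(-1)] by a copy of [M(-1)],
    embedded by [v] to [(- l v, v)]; that [l] is regular modulo [M] identifies this kernel. The
    shift raises the bound of [M(-1)] to [r + 1], which a kernel may have. *)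
Lemma reg_upto_addM k m (d : 'I_m -> nat) M (l : R) r :
  graded d M -> (forall a, shomog a a.+1 l) -> (forall v, M (l *: v) -> M v) ->
  (forall i, (d i).+1 <= r)%N -> (forall k, reg_upto k d M r) -> reg_upto k d (addM M l) r.
Proof.
case: k => // k hM hl nz hd hG.
pose d' i := (d i).+1.
have hphi : mxhomog (dsum d d') d (col_mx 1%:M l%:M).
  by apply: mxhomog_col; [exact: mxhomog1 | exact: mxhomog_scalar].
have ephi (v : 'rV[R]_(m + m)) : v *m col_mx 1%:M l%:M = lsubmx v + l *: rsubmx v.
  by rewrite -{1}(hsubmxK v) mul_row_col mulmx1 mul_mx_scalar.
have hB : graded (dsum d d') (@prodM m m M (fun=> True)) by apply: graded_prod.
have hT : graded d' (fun _ : 'rV[R]_m => True) by [].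
have hP := reg_upto_prod hM hT (hG k.+1) (@reg_upto_free K N k.+1 _ d' r hd).
have h := reg_upto_quot hB hphi hP.
 apply: reg_upto_ext (h _) => [v|].
  split=> [[b [[h1 _] ->]]|[u1 [u2 [h1 ->]]]].
    by rewrite ephi; exists (lsubmx b), (rsubmx b).
  exists (row_mx u1 u2); rewrite ephi row_mxKl row_mxKr /prodM.
  by rewrite row_mxKl.
have hpsi : mxhomog d' (dsum d d') (row_mx (- l%:M) 1%:M).
  by apply: mxhomog_row; [apply: mxhomogN; exact: mxhomog_scalar | exact: mxhomog1].
have epsi (v : 'rV[R]_m) : v *m row_mx (- l%:M) 1%:M = row_mx (- (l *: v)) v.
  by rewrite mul_mx_row mulmx1 mulmxN mul_mx_scalar.
apply: reg_upto_ext (reg_upto_iso hpsi _ (reg_upto_shift (hG k))) => [v|v _]; last first.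
  by rewrite epsi => /(congr1 rsubmx); rewrite row_mxKr => ->; apply/rowP => i; rewrite !mxE.
rewrite /kerM /prodM ephi; split=> [[b [Mb ->]]|[[h1 _] e]].
  rewrite epsi row_mxKl row_mxKr addNr; do !split=> //.
  by apply: (gradedN hM); apply: (gradedZ hM).
have e1 : lsubmx v = - (l *: rsubmx v) by apply/eqP; rewrite -addr_eq0 e.
exists (rsubmx v); rewrite epsi -e1 hsubmxK; split=> //.
by apply: nz; rewrite -[_ *: _]opprK -e1; apply: gradedN hM _.
Qed.

(* Nakayama: generators of [M + l F], with [F] the ambient free module, can be corrected
   by elements of [l F] into generators of [M], and the syzygies correspond modulo [l]. *)
Lemma reg_upto_regular k m (d : 'I_m -> nat) M (l : R) r :
  graded d M -> (forall a, shomog a a.+1 l) -> l != 0 -> (forall v, M (l *: v) -> M v) ->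
  (forall i, d i <= r)%N -> reg_upto k d (addM M l) r.+1 -> reg_upto k d M r.+1.
Proof.
elim: k m d M r => // k IH m d M r hM hl l0 nz hd hadd.
have [t [dd [h [h1 h2 h3 h4]]]] := hadd.
(* A graded component of a multiple of [l] is again a multiple of [l]; in degree 0 it vanishes. *)
have cpl s w : exists v, rvcomp d s (l *: w) = l *: v.
  case: s => [|s]; [exists 0 | exists (rvcomp d s w)]; apply/rowP => j; rewrite !mxE mulrC.
    by rewrite (hcompM _ _ (hl _)) hcompS0 mul0r mulr0.
  by rewrite (hcompM _ _ (hl _)) hcompSS mulrC.
have /fin_all_exists[g shomog'] i : exists g, [/\ rvhomog d (dd i) g, M g &
    exists v, row i h = g + l *: v].
  have [u [v [Mu e]]] : addM M l (row i h) by apply: gen_row h3.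
  exists (rvcomp d (dd i) u); split; [exact: rvcomp_homog | exact: (gradedC hM) | ].
  have [w ew] := cpl (dd i) v; exists w.
  rewrite -ew -rvcompD -e rvcomp_id // => k' j; rewrite mxE; exact: h1.
pose gm := \matrix_i g i.
have mxhomog' : mxhomog dd d gm by move=> i j; rewrite mxE; case: (shomog' i) => hh _ _; apply: hh.
have Mgm i : M (row i gm) by rewrite rowK; case: (shomog' i).
have hgen0 v : M v -> exists a w, v = a *m gm + l *: w.
  move=> Mv; have [a ea] : exists a, v = a *m h.
    by apply/h3; exists v, 0; rewrite scaler0 addr0.
  have /fin_all_exists[W hW] i : exists w, row i h = row i gm + l *: w.
    by rewrite rowK; case: (shomog' i).
  exists a, (\sum_i a 0 i *: W i); rewrite ea !mulmx_sum_row scaler_sumr -big_split /=.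
  by apply: eq_bigr => i _; rewrite hW scalerDr !scalerA mulrC.
(* Induction on the degree: the remainder [l w] lies in [M], hence so does the component of [w], in
   degree one less. *)
have hgenh s v : rvhomog d s v -> M v -> exists a, v = a *m gm.
  elim: s v => [|s IHs] v hv Mv; have [a [w e]] := hgen0 _ Mv.
    exists (rvcomp dd 0 a); rewrite -(rvcomp_mul _ _ mxhomog') -{1}(rvcomp_id hv) e rvcompD.
    rewrite [X in _ + X](_ : _ = 0) ?addr0 //; apply/rowP => j; rewrite !mxE mulrC.
    by rewrite (hcompM _ _ (hl _)) hcompS0 mul0r.
  have e1 : rvcomp d s.+1 (l *: w) = l *: rvcomp d s w.
    by apply/rowP => j; rewrite !mxE mulrC (hcompM _ _ (hl _)) hcompSS mulrC.
  have e2 : v = rvcomp dd s.+1 a *m gm + l *: rvcomp d s w.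
    by rewrite -(rvcomp_mul _ _ mxhomog') -e1 -rvcompD -e rvcomp_id.
  have [b eb] : exists b, rvcomp d s w = b *m gm.
    apply: IHs; first exact: rvcomp_homog.
    apply: nz; rewrite (_ : _ *: _ = v - rvcomp dd s.+1 a *m gm).
      by apply: (gradedB hM) => //; apply: graded_mul hM _.
    by rewrite e2 addrAC subrr add0r.
  by exists (rvcomp dd s.+1 a + l *: b); rewrite mulmxDl -scalemxAl -eb.
have hgen v : M v <-> exists a, v = a *m gm.
  split=> [Mv|[a ->]]; last exact: graded_mul hM _.
  have [B ->] := rvcomp_sumE d v.
  elim/big_ind: _ => [|x y [a ->] [b ->]|s _]; first by exists 0; rewrite mul0mx.
    by exists (a + b); rewrite mulmxDl.
  by apply: (hgenh s); [exact: rvcomp_homog | exact: (gradedC hM)].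
exists t, dd, gm; split=> //.
pose d' i := (d i).+1.
have hcol : mxhomog (dsum dd d') d (col_mx gm l%:M).
  by apply: mxhomog_col => //; exact: mxhomog_scalar.
have ecol (u : 'rV[R]_(t + m)) :
    u *m col_mx gm l%:M = lsubmx u *m gm + l *: rsubmx u.
  by rewrite -{1}(hsubmxK u) mul_row_col mul_mx_scalar.
(* These are the syzygies of [gm] together with [l] times the basis. Their first blocks are the
   vectors that [gm] sends into multiples of [l], that is, the syzygies of [gm] plus multiples of
   [l]. *)
have hZ : reg_upto k (dsum dd d') (fun u => u *m col_mx gm l%:M = 0) r.+2.
  apply: (reg_upto_indep hadd hcol).
    apply: dsum_le => i; first by apply: leq_trans (h2 i) _.
    by rewrite ltnS; apply: leq_trans (hd i) _.
  move=> v; split=> [[u [w [/hgen[a ->] ->]]]|[a ->]].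
    by exists (row_mx a w); rewrite ecol row_mxKl row_mxKr.
  rewrite ecol; exists (lsubmx a *m gm), (rsubmx a); split=> //.
  by apply/hgen; exists (lsubmx a).
have Zinj (v : 'rV[R]_m) : l *: v = 0 -> v = 0.
  move=> e; apply/rowP => j; have /eqP := congr1 (fun w : 'rV_m => w 0 j) e.
  by rewrite !mxE mulf_eq0 (negPf l0) => /eqP.
apply: (IH _ dd) => //.
- exact: graded_syz mxhomog'.
- by move=> v; rewrite -scalemxAl => /Zinj.
apply: reg_upto_ext (reg_upto_iso (mxhomog_inl dd d') _ hZ) => [v|v].
  rewrite /imM; split=> [[b [e ->]]|[u [w [e ->]]]].
    move: e; rewrite ecol mul_inl => e.
    have e1 : lsubmx b *m gm = - (l *: rsubmx b) by apply/eqP; rewrite -addr_eq0 e.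
    have [c ec] : exists c, rsubmx b = c *m gm.
      apply/hgen/nz; rewrite -[_ *: _]opprK -e1.
      by apply: (gradedN hM); apply/hgen; exists (lsubmx b).
    exists (lsubmx b + l *: c), (- c); split; last by rewrite scalerN addrK.
    by rewrite mulmxDl -scalemxAl -ec e1 addNr.
  exists (row_mx (u + l *: w) (- (w *m gm))); rewrite ecol mul_inl row_mxKl row_mxKr.
  by rewrite mulmxDl e add0r -scalemxAl scalerN subrr.
rewrite ecol mul_inl -{4}(hsubmxK v) => e1 e2; move: e1.
by rewrite e2 mul0mx add0r => /Zinj ->; rewrite row_mx0.
Qed.

End RegularElements.

(** * Ideals *)

Section Ideals.
Variables (K : fieldType) (N : nat).
Local Notation R := {mpoly K[N]}.
Implicit Types (J : R -> Prop) (p q : R) (r : nat).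

Record ideal J : Prop := Ideal {
  ideal0 : J 0;
  idealD : forall p q, J p -> J q -> J (p + q);
  idealM : forall c p, J p -> J (c * p) }.

Lemma idealN J p : ideal J -> J p -> J (- p).
Proof. by move=> h Jp; rewrite -mulN1r; apply: (idealM h). Qed.

Lemma idealB J p q : ideal J -> J p -> J q -> J (p - q).
Proof. by move=> h Jp Jq; apply: (idealD h) => //; apply: idealN. Qed.

Lemma ideal_sum J (I : eqType) (s : seq I) (F : I -> R) :
  ideal J -> (forall i, i \in s -> J (F i)) -> J (\sum_(i <- s) F i).
Proof.
move=> h hF; rewrite big_seq; apply: big_ind => //; [exact: ideal0 h | exact: idealD h].
Qed.

Definition gideal J := ideal J /\ forall s p, J p -> J (hcomp 0 s p).

Definition d0 (i : 'I_1) := 0%N.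
Definition rowJ J (v : 'rV[R]_1) := J (v 0 0).

(* The ideal [J], as an S-module, has regularity at most [r]. *)
Definition reg_le J r := forall k, reg_upto k d0 (rowJ J) r.

Lemma graded_rowJ J : gideal J -> graded d0 (rowJ J).
Proof.
case=> -[h0 hD hM] hC; split=> [|u v hu hv|c v hv|s v hv]; rewrite /rowJ mxE //.
- exact: hD.
- exact: hM.
- exact: hC.
Qed.

Lemma reg_le_ext J J' r : (forall p, J p <-> J' p) -> reg_le J r -> reg_le J' r.
Proof. by move=> e h k; apply: (reg_upto_ext _ (h k)) => v; exact: e. Qed.

Lemma reg_le_mono J r r' : (r <= r')%N -> reg_le J r -> reg_le J r'.
Proof. by move=> hr h k; exact: (reg_upto_mono hr (h k)). Qed.

Lemma reg_le_zero J r : (forall p, J p <-> p = 0) -> reg_le J r.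
Proof.
move=> e k; apply: (reg_upto_ext _ (@reg_upto_zero K N k 1 d0 r)) => v; rewrite /rowJ e.
split=> [->|h]; first by rewrite mxE.
by apply/rowP => i; rewrite ord1 h mxE.
Qed.

Lemma reg_le_cap J1 J2 r :
  gideal J1 -> gideal J2 -> reg_le J1 r.+1 -> reg_le J2 r.+1 ->
  reg_le (fun p => exists p1 p2, [/\ J1 p1, J2 p2 & p = p1 + p2]) r ->
  reg_le (fun p => J1 p /\ J2 p) r.+1.
Proof.
move=> /graded_rowJ h1 /graded_rowJ h2 g1 g2 g12 k.
apply: reg_upto_cap h1 h2 (g1 k) (g2 k) _; apply: (reg_upto_ext _ (g12 k.+1)) => v; rewrite /rowJ.
split=> [[p1 [p2 [j1 j2 e]]]|[u1 [u2 [j1 j2 ->]]]].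
  exists (p1%:M), (p2%:M); rewrite !mxE !mulr1n; split=> //.
  by apply/rowP => i; rewrite ord1 e !mxE !mulr1n.
by exists (u1 0 0), (u2 0 0); rewrite mxE.
Qed.

Lemma rowJ_addM J l v :
  addM (rowJ J) l v <-> rowJ (fun p => exists u q, J u /\ p = u + l * q) v.
Proof.
rewrite /addM /rowJ; split=> [[u [w [Ju ->]]]|[u [q [Ju e]]]].
  by exists (u 0 0), (w 0 0); rewrite !mxE.
exists (u%:M), (q%:M); rewrite mxE mulr1n; split=> //.
by apply/rowP => i; rewrite ord1 e !mxE !mulr1n.
Qed.

Lemma reg_le_add_var J z r :
  gideal J -> (forall p, J ('X_z * p) -> J p) -> (0 < r)%N ->
  reg_le J r -> reg_le (fun p => exists u q, J u /\ p = u + 'X_z * q) r.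
Proof.
move=> hJ nz r0 g k; apply: (reg_upto_ext (rowJ_addM _ _)).
apply: (@reg_upto_addM _ _ k _ d0 (rowJ J) 'X_z r (graded_rowJ hJ)) => //.
- by move=> a; exact: shomogX.
- by move=> v; rewrite /rowJ mxE; exact: nz.
Qed.

Lemma reg_le_regular J z r :
  gideal J -> (forall p, J ('X_z * p) -> J p) ->
  reg_le (fun p => exists u q, J u /\ p = u + 'X_z * q) r.+1 -> reg_le J r.+1.
Proof.
move=> hJ nz g k.
apply: (@reg_upto_regular _ _ k _ d0 (rowJ J) 'X_z r (graded_rowJ hJ)) => //.
- by move=> a; exact: shomogX.
- by rewrite -msize_poly_eq0 msizeX.
- by move=> v; rewrite /rowJ mxE; exact: nz.
- by apply: (reg_upto_ext _ (g k)) => v; rewrite rowJ_addM.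
Qed.

Definition zeta (z : 'I_N) p : R :=
  p \mPo [tuple (if i == z then 0 else 'X_i) | i < N].

Lemma zetaD z p q : zeta z (p + q) = zeta z p + zeta z q.
Proof. exact: rmorphD. Qed.
Lemma zetaB z p q : zeta z (p - q) = zeta z p - zeta z q.
Proof. exact: rmorphB. Qed.
Lemma zetaM z p q : zeta z (p * q) = zeta z p * zeta z q.
Proof. exact: rmorphM. Qed.
Lemma zeta0 z : zeta z 0 = 0.
Proof. exact: rmorph0. Qed.
Lemma zeta_sum z (I : Type) (s : seq I) (P : pred I) (F : I -> R) :
  zeta z (\sum_(i <- s | P i) F i) = \sum_(i <- s | P i) zeta z (F i).
Proof. exact: rmorph_sum. Qed.

Lemma zetaX z i : zeta z 'X_i = if i == z then 0 else 'X_i.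
Proof. by rewrite /zeta comp_mpolyXU -tnth_nth tnth_mktuple. Qed.

Lemma mpoly_ring_ind (P : R -> Prop) :
  (forall c, P c%:MP) -> (forall i, P 'X_i) ->
  (forall p q, P p -> P q -> P (p + q)) -> (forall p q, P p -> P q -> P (p * q)) ->
  forall p, P p.
Proof.
move=> PC PX PD PM p; rewrite (mpolyE p).
have P1 : P 1 by rewrite -mpolyC1.
apply: big_ind => [||u _]; [by rewrite -mpolyC0 | exact: PD | ].
rewrite -mul_mpolyC; apply: (PM) => //; rewrite mpolyXE_id.
apply: big_ind => [||i _]; [exact: P1 | exact: PM | ].
by elim: (u i) => [|k IHk]; [exact: P1 | rewrite exprS; apply: PM].
Qed.

Lemma zeta_dec z p : exists q, p = zeta z p + q * 'X_z.
Proof.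
elim/mpoly_ring_ind: p => [c|i|p q [p' ep] [q' eq]|p q [p' ep] [q' eq]].
- by exists 0; rewrite mul0r addr0 /zeta comp_mpolyC.
- rewrite zetaX; case: eqP => [->|_]; first by exists 1; rewrite add0r mul1r.
  by exists 0; rewrite mul0r addr0.
- by exists (p' + q'); rewrite zetaD {1}ep {1}eq; ring.
- exists (zeta z p * q' + p' * zeta z q + p' * q' * 'X_z).
  by rewrite zetaM {1}ep {1}eq; ring.
Qed.

Lemma zetaK z p : zeta z (zeta z p) = zeta z p.
Proof.
elim/mpoly_ring_ind: p => [c|i|p q hp hq|p q hp hq].
- by rewrite /zeta !comp_mpolyC.
- by rewrite zetaX; case: ifP => [_|h]; rewrite ?zeta0 // zetaX h.
- by rewrite !zetaD hp hq.
- by rewrite !zetaM hp hq.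
Qed.

Lemma zeta_comm z t p : zeta z (zeta t p) = zeta t (zeta z p).
Proof.
elim/mpoly_ring_ind: p => [c|i|p q hp hq|p q hp hq].
- by rewrite /zeta !comp_mpolyC.
- by rewrite !zetaX; case: ifP => h; case: ifP => h'; rewrite ?zeta0 ?zetaX ?h ?h'.
- by rewrite !zetaD hp hq.
- by rewrite !zetaM hp hq.
Qed.

End Ideals.

(** * Binomial edge ideals *)

Section EdgeIdeals.
Variables (K : fieldType) (n : nat).
Local Notation R := {mpoly K[n + n]}.
Implicit Types (e : rel 'I_n) (Z : seq 'I_(n + n)) (p q : R) (i j v m : 'I_n).
Local Notation x := (xv K).
Local Notation y := (yv K).
Local Notation f := (fbin K).

(* Deleting a vertex is encoded by isolating it, so that all ideals live in one ring;
   [Z] lists variables added to the generators. *)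
Inductive edge_ideal e Z : R -> Prop :=
| edge_ideal0 : edge_ideal e Z 0
| edge_idealD p q : edge_ideal e Z p -> edge_ideal e Z q -> edge_ideal e Z (p + q)
| edge_idealf c i j : e i j -> edge_ideal e Z (c * f i j)
| edge_idealx c z : z \in Z -> edge_ideal e Z (c * 'X_z).

Lemma edge_ideal_ideal e Z : ideal (edge_ideal e Z).
Proof.
split=> [|p q|c p]; [exact: edge_ideal0 | exact: edge_idealD | ].
elim=> [|{}p q _ hp _ hq|c' i j eij|c' z zZ].
- by rewrite mulr0; exact: edge_ideal0.
- by rewrite mulrDr; exact: edge_idealD.
- by rewrite mulrA; exact: edge_idealf.
- by rewrite mulrA; exact: edge_idealx.
Qed.

Lemma edge_ideal_sub e Z (J : R -> Prop) p : ideal J ->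
  (forall i j, e i j -> J (f i j)) -> (forall z, z \in Z -> J 'X_z) -> edge_ideal e Z p -> J p.
Proof.
move=> hJ hf hz; elim=> [|{}p q _ hp _ hq|c i j eij|c z zZ].
- exact: (ideal0 hJ).
- exact: (idealD hJ).
- by apply: (idealM hJ); exact: hf.
- by apply: (idealM hJ); exact: hz.
Qed.

Lemma edge_ideal_gen e Z i j : e i j -> edge_ideal e Z (f i j).
Proof. by move=> eij; rewrite -[f i j]mul1r; apply: edge_idealf. Qed.

Lemma edge_ideal_var e Z z : z \in Z -> edge_ideal e Z 'X_z.
Proof. by move=> zZ; rewrite -['X_z]mul1r; apply: edge_idealx. Qed.

Lemma edge_ideal_mono e e' Z Z' p : (forall i j, e i j -> e' i j) -> {subset Z <= Z'} ->
  edge_ideal e Z p -> edge_ideal e' Z' p.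
Proof.
move=> he hZ; apply: edge_ideal_sub (edge_ideal_ideal _ _) _ _ => [i j /he|z /hZ].
  exact: edge_ideal_gen.
exact: edge_ideal_var.
Qed.

Lemma edge_ideal_f_in e Z i j : lshift n i \in Z -> rshift n i \in Z -> edge_ideal e Z (f i j).
Proof.
move=> h1 h2; rewrite /fbin /xv /yv; apply: idealB (edge_ideal_ideal _ _) _ _.
  by rewrite mulrC; apply: edge_idealx.
by apply: edge_idealx.
Qed.

Lemma edge_ideal_f_in2 e Z i j : lshift n j \in Z -> rshift n j \in Z -> edge_ideal e Z (f i j).
Proof.
move=> h1 h2; rewrite /fbin /xv /yv; apply: idealB (edge_ideal_ideal _ _) _ _.
  by apply: edge_idealx.
by rewrite mulrC; apply: edge_idealx.
Qed.

Lemma edge_ideal_f_xx e Z i j : lshift n i \in Z -> lshift n j \in Z -> edge_ideal e Z (f i j).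
Proof.
move=> h1 h2; rewrite /fbin /xv /yv; apply: idealB (edge_ideal_ideal _ _) _ _.
  by rewrite mulrC; apply: edge_idealx.
by rewrite mulrC; apply: edge_idealx.
Qed.

Lemma fbinC i j : f j i = - f i j.
Proof. by rewrite /fbin; ring. Qed.

Lemma edge_ideal_gideal e Z : gideal (edge_ideal e Z).
Proof.
split; first exact: edge_ideal_ideal.
move=> s p; elim=> [|{}p q _ hp _ hq|c i j eij|c z zZ].
- by rewrite hcomp0; exact: edge_ideal0.
- by rewrite hcompD; exact: edge_idealD.
- rewrite (@hcompM _ _ 0 2 s); first exact: edge_idealf.
  by apply: shomogB; apply: (@shomogM _ _ 0 1 2); exact: shomogX.
- by rewrite (@hcompM _ _ 0 1 s); [exact: edge_idealx | exact: shomogX].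
Qed.

Lemma edge_ideal_cons e Z z p :
  edge_ideal e (z :: Z) p <-> exists u q, edge_ideal e Z u /\ p = u + 'X_z * q.
Proof.
split=> [|[u [q [hu ->]]]]; last first.
  apply: edge_idealD; last by rewrite mulrC; apply: edge_idealx; rewrite inE eqxx.
  by apply: edge_ideal_mono hu => // t tZ; rewrite inE tZ orbT.
elim=> [|{}p q _ [u [a [hu ->]]] _ [w [b [hw ->]]]|c i j eij|c t].
- by exists 0, 0; split; [exact: edge_ideal0 | rewrite mulr0 addr0].
- by exists (u + w), (a + b); split; [exact: edge_idealD | ring].
- by exists (c * f i j), 0; split; [exact: edge_idealf | rewrite mulr0 addr0].
- rewrite inE => /orP[/eqP->|tZ]; first by exists 0, c; split; [exact: edge_ideal0 | ring].
  by exists (c * 'X_t), 0; split; [exact: edge_idealx | rewrite mulr0 addr0].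
Qed.

(** The variable [z] does not occur in the binomials of the edges. *)
Definition freevar e (z : 'I_(n + n)) := forall i j, e i j -> zeta z (f i j) = f i j.

Lemma zeta_x i j : zeta (lshift n i) (x j) = if j == i then 0 else x j.
Proof. by rewrite zetaX (inj_eq (@lshift_inj _ _)). Qed.
Lemma zeta_y i j : zeta (lshift n i) (y j) = y j.
Proof. by rewrite zetaX eq_rlshift. Qed.
Lemma zetay_x i j : zeta (rshift n i) (x j) = x j.
Proof. by rewrite zetaX eq_lrshift. Qed.
Lemma zetay_y i j : zeta (rshift n i) (y j) = if j == i then 0 else y j.
Proof. by rewrite zetaX (inj_eq (@rshift_inj _ _)). Qed.

Lemma freevarP e v : (forall i j, e i j -> (i != v) && (j != v)) ->
  freevar e (lshift n v) /\ freevar e (rshift n v).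
Proof.
move=> h; split=> i j /h /andP[/negPf hi /negPf hj];
by rewrite /fbin zetaB !zetaM ?zeta_x ?zeta_y ?zetay_x ?zetay_y hi hj.
Qed.

Lemma zeta_edge_ideal e Z z p : freevar e z -> edge_ideal e Z p -> edge_ideal e [seq t <- Z | t != z] (zeta z p).
Proof.
move=> fz; elim=> [|{}p q _ hp _ hq|c i j eij|c t tZ].
- by rewrite zeta0; exact: edge_ideal0.
- by rewrite zetaD; exact: edge_idealD.
- by rewrite zetaM fz //; exact: edge_idealf.
- rewrite zetaM zetaX; case: eqP => [_|/eqP tz]; first by rewrite mulr0; exact: edge_ideal0.
  by apply: edge_idealx; rewrite mem_filter tz.
Qed.

Lemma zeta_edge_ideal_nil e Z z p : freevar e z -> edge_ideal e Z p -> {subset Z <= [:: z]} ->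
  edge_ideal e [::] (zeta z p).
Proof.
move=> fz /(zeta_edge_ideal fz) h sZ; apply: edge_ideal_mono h => // t.
by rewrite mem_filter => /andP[tz /sZ]; rewrite inE (negPf tz).
Qed.

(** As the generators do not involve [z], an element of the ideal is its value at [z = 0] plus
    ['X_z] times an element of the ideal. For a multiple of ['X_z] the value is zero, and ['X_z]
    cancels. *)
Lemma edge_ideal_regular e Z z p : freevar e z -> z \notin Z -> edge_ideal e Z ('X_z * p) -> edge_ideal e Z p.
Proof.
move=> fz nZ.
have dec q : edge_ideal e Z q -> exists q', edge_ideal e Z q' /\ q = zeta z q + q' * 'X_z.
  elim=> [|a b _ [a' [ha ea]] _ [b' [hb eb]]|c i j eij|c t tZ].
  - by exists 0; split; [exact: edge_ideal0 | rewrite zeta0 mul0r addr0].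
  - exists (a' + b'); split; first exact: edge_idealD.
    by rewrite zetaD {1}ea {1}eb; ring.
  - have [c' ec] := zeta_dec z c; exists (c' * f i j); split; first exact: edge_idealf.
    by rewrite zetaM fz // {1}ec; ring.
  - have [c' ec] := zeta_dec z c; exists (c' * 'X_t); split; first exact: edge_idealx.
    rewrite zetaM zetaX (_ : t == z = false); last first.
      by apply: contraNF nZ => /eqP <-.
    by rewrite {1}ec; ring.
move=> /dec[q [hq]]; rewrite zetaM zetaX eqxx mul0r add0r mulrC => /eqP.
have X0 : 'X_z != 0 :> R by rewrite -msize_poly_eq0 msizeX.
by rewrite -subr_eq0 -mulrBl mulf_eq0 (negPf X0) orbF subr_eq0 => /eqP ->.
Qed.

Lemma reg_le_vars e Z r : (forall z, z \in Z -> freevar e z) -> (0 < r)%N ->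
  reg_le (edge_ideal e [::]) r -> reg_le (edge_ideal e Z) r.
Proof.
move=> hZ r0 g; elim: Z hZ => [|z Z IH] hZ //.
have {}IH := IH (fun t tZ => hZ t (mem_behead (s := z :: Z) tZ)).
case: (boolP (z \in Z)) => zZ.
  apply: (reg_le_ext _ IH) => p; split; apply: edge_ideal_mono => // t.
    by rewrite inE => ->; rewrite orbT.
  by rewrite inE => /orP[/eqP->|].
apply: (reg_le_ext (fun p => iff_sym (edge_ideal_cons e Z z p))).
apply: reg_le_add_var (edge_ideal_gideal _ _) _ r0 IH => p.
by apply: edge_ideal_regular zZ; apply: hZ; rewrite inE eqxx.
Qed.

(** * The intersection formula at a vertex *)

Section Ohtani.
Variables (e : rel 'I_n) (v : 'I_n).
Hypothesis eirr : irreflexive e.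

Definition del e v : rel 'I_n := fun i j => [&& e i j, i != v & j != v].
(* [G_v], for the graph [e]. *)
Definition cone e v : rel 'I_n := fun i j => e i j || [&& e v i, e v j & i != j].
Definition xy v : seq 'I_(n + n) := [:: lshift n v; rshift n v].

Lemma del_freevar e' : freevar (del e' v) (lshift n v) /\ freevar (del e' v) (rshift n v).
Proof. by apply: freevarP => i j /and3P[_ -> ->]. Qed.

Lemma edge_ideal_del_xy p : edge_ideal e [::] p -> edge_ideal (del e v) (xy v) p.
Proof.
apply: edge_ideal_sub (edge_ideal_ideal _ _) _ _ => // i j eij.
have [->|iv] := eqVneq i v; first by apply: edge_ideal_f_in; rewrite !inE eqxx ?orbT.
have [->|jv] := eqVneq j v; first by apply: edge_ideal_f_in2; rewrite !inE eqxx ?orbT.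
by apply: edge_ideal_gen; rewrite /del eij iv jv.
Qed.

Let zt p := zeta (rshift n v) (zeta (lshift n v) p).

Lemma zt_edge_ideal p : edge_ideal (del e v) (xy v) p -> edge_ideal (del e v) [::] (zt p).
Proof.
have [fx fy] := del_freevar e.
move=> /(zeta_edge_ideal fx) h; apply: (zeta_edge_ideal_nil fy h) => t.
by rewrite mem_filter !inE => /andP[/negPf -> /=].
Qed.

(* A coefficient of [f a b], for neighbours [a], [b] of [v], only matters modulo
   [x v] and [y v], since [x v * f a b] and [y v * f a b] lie in [J e]. *)
Lemma cone_dec p : edge_ideal (cone e v) [::] p ->
  exists s, zt s = s /\ edge_ideal e [::] (p - s).
Proof.
have hI := edge_ideal_ideal e [::].
elim=> [|a b _ [sa [ha ea]] _ [sb [hb eb]]|c i j|//].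
- by exists 0; rewrite /zt !zeta0 subr0; split=> //; exact: edge_ideal0.
- exists (sa + sb); rewrite /zt !zetaD -/(zt _) -/(zt _) ha hb; split=> //.
  by rewrite opprD addrACA; exact: edge_idealD.
- case/orP=> [eij|/and3P[ei ej ij]].
    by exists 0; rewrite /zt !zeta0 subr0; split=> //; exact: edge_idealf.
  have iv : (i == v) = false by apply: contraTF ei => /eqP ->; rewrite eirr.
  have jv : (j == v) = false by apply: contraTF ej => /eqP ->; rewrite eirr.
  have [c1 e1] := zeta_dec (lshift n v) c.
  have [c2 e2] := zeta_dec (rshift n v) (zeta (lshift n v) c).
  have zf : zt (f i j) = f i j.
    rewrite /zt /fbin zetaB !zetaM !zeta_x !zeta_y iv jv zetaB !zetaM.
    by rewrite !zetay_x !zetay_y iv jv.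
  have zz q : zt (zt q) = zt q by rewrite /zt (zeta_comm _ (rshift n v)) !zetaK.
  exists (zt c * f i j); split; first by rewrite {1}/zt !zetaM -!/(zt _) zz zf.
  (* From [x_v f_ij = x_i f_vj - x_j f_vi] and its analogue for [y_v], applied to the parts of [c]
     divisible by [x_v] and [y_v]. *)
  have -> : c * f i j - zt c * f i j =
      (c2 * y i + c1 * x i) * f v j + (- (c2 * y j + c1 * x j)) * f v i.
    by rewrite {1}e1 {1}e2 /zt /fbin /xv /yv; ring.
  by apply: edge_idealD; apply: edge_idealf.
Qed.

(** By [cone_dec], modulo [J_G] an element of the first ideal is free of [x_v] and [y_v]. Lying in
    the second as well, it is unchanged when both variables are put to 0, which lands it in the
    ideal of [G - v], inside [J_G]. *)
Lemma ohtani p :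
  edge_ideal (cone e v) [::] p /\ edge_ideal (del e v) (xy v) p <-> edge_ideal e [::] p.
Proof.
split=> [[/cone_dec[s [zs hs]] h]|h]; last first.
  by split; [apply: edge_ideal_mono h => // i j eij; rewrite /cone eij | exact: edge_ideal_del_xy].
rewrite -(subrK s p); apply: edge_idealD => //.
have : edge_ideal (del e v) (xy v) s.
  rewrite (_ : s = p - (p - s)); last by rewrite opprB addrCA subrr addr0.
  by apply: idealB (edge_ideal_ideal _ _) h _; exact: edge_ideal_del_xy.
move=> /zt_edge_ideal; rewrite zs; apply: edge_ideal_mono => // i j.
by case/and3P.
Qed.

Lemma ohtani_sum p :
  (exists p1 p2, [/\ edge_ideal (cone e v) [::] p1, edge_ideal (del e v) (xy v) p2 & p = p1 + p2])
  <-> edge_ideal (del (cone e v) v) (xy v) p.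
Proof.
split=> [[p1 [p2 [h1 h2 ->]]]|].
  apply: edge_idealD.
    apply: edge_ideal_sub (edge_ideal_ideal _ _) _ _ h1 => // i j eij.
    have [->|iv] := eqVneq i v; first by apply: edge_ideal_f_in; rewrite !inE eqxx ?orbT.
    have [->|jv] := eqVneq j v; first by apply: edge_ideal_f_in2; rewrite !inE eqxx ?orbT.
    by apply: edge_ideal_gen; rewrite /del eij iv jv.
  by apply: edge_ideal_mono h2 => // i j /and3P[eij iv jv]; rewrite /del /cone eij iv jv.
elim=> [|a b _ [a1 [a2 [h1 h2 ->]]] _ [b1 [b2 [k1 k2 ->]]]|c i j /and3P[h _ _]|c z hz].
- by exists 0, 0; rewrite addr0; split=> //; exact: edge_ideal0.
- by exists (a1 + b1), (a2 + b2); rewrite addrACA; split=> //; exact: edge_idealD.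
- by exists (c * f i j), 0; rewrite addr0; split=> //; [exact: edge_idealf | exact: edge_ideal0].
- by exists 0, (c * 'X_z); rewrite add0r; split=> //; [exact: edge_ideal0 | exact: edge_idealx].
Qed.

Lemma reg_le_xy e' r : (0 < r)%N -> reg_le (edge_ideal (del e' v) [::]) r -> reg_le (edge_ideal (del e' v) (xy v)) r.
Proof.
move=> r0 g; apply: reg_le_vars r0 g => z; have [fx fy] := del_freevar e'.
by rewrite !inE => /orP[] /eqP ->.
Qed.

Lemma reg_le_ohtani r : (0 < r)%N ->
  reg_le (edge_ideal (cone e v) [::]) r.+1 -> reg_le (edge_ideal (del e v) [::]) r.+1 ->
  reg_le (edge_ideal (del (cone e v) v) [::]) r -> reg_le (edge_ideal e [::]) r.+1.
Proof.
move=> r0 g1 g2 g3; apply: reg_le_ext ohtani _.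
apply: reg_le_cap (edge_ideal_gideal _ _) (edge_ideal_gideal _ _) g1 _ _; first exact: reg_le_xy.
by apply: reg_le_ext (fun p => iff_sym (ohtani_sum p)) _; exact: reg_le_xy.
Qed.

End Ohtani.
End EdgeIdeals.

(** * Disjoint unions of cliques *)

Section Cliques.
Variables (K : fieldType) (n : nat).
Local Notation R := {mpoly K[n + n]}.
Local Notation x := (xv K).
Local Notation y := (yv K).
Local Notation f := (fbin K).
Local Notation edge_ideal := (@edge_ideal K n).
Variables (e : rel 'I_n) (m : 'I_n).
Hypotheses (eirr : irreflexive e) (esym : ssrbool.symmetric e).

(* Disjoint unions of complete graphs. *)
Definition cliques e := forall u v w : 'I_n, e u v -> e v w -> u != w -> e u w.
Hypothesis ecl : cliques e.

Let C i := (i == m) || e m i.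

(** Isolates the whole component of [m], which in a disjoint union of cliques is [m] with its
    neighbours. *)
Definition del_comp e m : rel 'I_n :=
  fun i j => [&& e i j, ~~ ((i == m) || e m i) & ~~ ((j == m) || e m j)].
Local Notation eC := (del_comp e m).

Lemma comp_closed i j : e i j -> C i -> C j.
Proof.
move=> eij; rewrite /C => /orP[/eqP <-|emi]; first by rewrite eij orbT.
have [//|jm] := eqVneq j m.
by rewrite (ecl emi eij) // eq_sym.
Qed.

Lemma eC_del i j : eC i j -> del e m i j.
Proof. by case/and3P=> h; rewrite !negb_or /del => /andP[-> _] /andP[-> _]; rewrite h. Qed.

Lemma del_e i j : del e m i j -> e i j.
Proof. by case/and3P. Qed.

Lemma eC_e i j : eC i j -> e i j.
Proof. by move/eC_del/del_e. Qed.

Lemma eC_freevar i : C i ->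
  freevar K eC (lshift n i) /\ freevar K eC (rshift n i).
Proof.
move=> Ci; apply: freevarP => a b /and3P[_ na nb].
by rewrite (contraNneq _ na) ?(contraNneq _ nb) // => ->.
Qed.

(* The syzygies of the variables [x i] modulo the ideal of the other components
   are generated by the Koszul relations, on which replacing x by y yields [f i j]. *)
Lemma clique_xy_var (s : seq 'I_n) (a : 'I_n -> R) : uniq s -> all (e m) s ->
  edge_ideal eC [::] (\sum_(i <- s) a i * x i) -> edge_ideal (del e m) [::] (\sum_(i <- s) a i * y i).
Proof.
elim: s a => [|t s IH] a; first by rewrite !big_nil => *; exact: edge_ideal0.
rewrite /= => /andP[ts us] /andP[et es]; rewrite !big_cons => h.
have Ct : C t by rewrite /C et orbT.
have [fx _] := eC_freevar Ct.
(* [x_t] is regular modulo the ideal of [eC] and the remaining [x_i], so [a t] lies in that ideal;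
   substituting it leaves a relation on [s] alone. *)
have [k [h0 [hh0 ea]]] : exists k h, edge_ideal eC [::] h /\ a t = h + \sum_(i <- s) k i * x i.
  have : edge_ideal eC [seq lshift n i | i <- s] (a t).
    apply: (edge_ideal_regular fx); first by rewrite mem_map //; exact: lshift_inj.
    rewrite mulrC -[_ * _](addrK (\sum_(i <- s) a i * x i)).
    apply: idealB (edge_ideal_ideal _ _ _) _ _; first by apply: edge_ideal_mono h.
    apply: ideal_sum (edge_ideal_ideal _ _ _) _ => i si; apply: edge_idealx; exact: map_f.
  move: (a t) => p; clear -us.
  elim: s p us => [|i s IH] p; first by exists (fun=> 0), p; rewrite big_nil addr0.
  rewrite /= => /andP[si us] /edge_ideal_cons[u [q [/IH -/(_ us)[k [h [hh ->]]] ->]]].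
  exists (fun j => if j == i then q else k j), h; split=> //.
  rewrite big_cons eqxx -addrA [_ + 'X_ _ * q]addrC [q * _]mulrC; congr (_ + (_ + _)).
  by apply: eq_big_seq => j js; case: eqP js => // ->; rewrite (negPf si).
have {}IH := IH (fun i => a i + k i * x t) us es.
have hs : edge_ideal (del e m) [::] (\sum_(i <- s) (a i + k i * x t) * y i).
  apply: IH.
  rewrite (_ : \sum_(i <- s) _ = (a t * x t + \sum_(i <- s) a i * x i) - h0 * x t).
    by apply: idealB (edge_ideal_ideal _ _ _) h _; rewrite mulrC; apply: idealM (edge_ideal_ideal _ _ _) _ _ _.
  rewrite ea mulrDl addrAC [h0 * _ + _]addrC addrK mulr_suml addrC -big_split /=.
  by apply: eq_bigr => i _; ring.
rewrite (_ : _ + _ = y t * h0 + \sum_(i <- s) (a i + k i * x t) * y i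
   + \sum_(i <- s) k i * f i t); last first.
  rewrite ea mulrDl mulr_suml [y t * h0]mulrC -!addrA -!big_split /=; congr (_ + _).
  by apply: eq_bigr => i _; rewrite /fbin; ring.
apply: edge_idealD; first apply: edge_idealD => //.
  by apply: idealM (edge_ideal_ideal _ _ _) _ _ _; apply: edge_ideal_mono hh0 => // i j; exact: eC_del.
apply: ideal_sum (edge_ideal_ideal _ _ _) _ => i si; apply: edge_idealf.
have emi := allP es _ si.
have it : i != t by apply: contraNneq ts => <-.
rewrite /del (ecl (_ : e i m) et it) /=; last by rewrite esym.
by apply/andP; split; [apply: contraTneq emi | apply: contraTneq et] => ->; rewrite eirr.
Qed.

Lemma sum_delta (i : 'I_n) (c : R) (F : 'I_n -> R) : e m i ->
  \sum_(j | e m j) (if j == i then c else 0) * F j = c * F i.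
Proof.
move=> emi; rewrite (bigD1 i) //= eqxx big1 ?addr0 // => j /andP[_ /negPf ->].
by rewrite mul0r.
Qed.

(** Since [f_ij = y_j x_i - y_i x_j], edges inside the clique give relations that vanish when each
    outer [x] is replaced by [y]. Once they are subtracted, only the ideal of the other components
    is left, where [clique_xy_var] applies. *)
Lemma clique_xy (c : 'I_n -> R) :
  edge_ideal (del e m) [::] (\sum_(i | e m i) c i * x i) ->
  edge_ideal (del e m) [::] (\sum_(i | e m i) c i * y i).
Proof.
have dec p : edge_ideal (del e m) [::] p -> exists d h, [/\ edge_ideal eC [::] h,
    p = \sum_(i | e m i) d i * x i + h & \sum_(i | e m i) d i * y i = 0].
  elim=> [|a b _ [da [ha [h1 -> h3]]] _ [db [hb [k1 -> k3]]]|c' i j eij|//].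
  - by exists (fun=> 0), 0; split; [exact: edge_ideal0 | |];
       rewrite ?addr0 big1 // => i _; rewrite mul0r.
  - exists (fun i => da i + db i), (ha + hb).
    split; first exact: edge_idealD.
      under [in RHS]eq_bigr => i _ do rewrite mulrDl.
      by rewrite big_split /= addrACA.
    under eq_bigr => i _ do rewrite mulrDl.
    by rewrite big_split /= h3 k3 addr0.
  - have [eij' im jm] := and3P eij.
    have [Ci|nCi] := boolP (C i); last first.
      exists (fun=> 0), (c' * f i j); split.
      + apply: edge_idealf; rewrite /del_comp eij' nCi /=; apply: contra nCi.
        by apply: comp_closed; rewrite esym.
      + by rewrite big1 ?add0r // => k _; rewrite mul0r.
      + by rewrite big1 // => k _; rewrite mul0r.
    have Cj := comp_closed eij' Ci.
    move: Ci Cj; rewrite /C (negPf im) (negPf jm) /= => Ci Cj.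
    exists (fun k => (if k == i then c' * y j else 0) + (if k == j then - (c' * y i) else 0)), 0.
    split; first exact: edge_ideal0.
      under eq_bigr => k _ do rewrite mulrDl.
      by rewrite big_split /= !sum_delta // /fbin; ring.
    under eq_bigr => k _ do rewrite mulrDl.
    by rewrite big_split /= !sum_delta //; ring.
move=> /dec[d [h [hh e1 e2]]].
have -> : \sum_(i | e m i) c i * y i = \sum_(i | e m i) (c i - d i) * y i.
  under [in RHS]eq_bigr => k _ do rewrite mulrBl.
  by rewrite sumrB e2 subr0.
have : edge_ideal eC [::] (\sum_(i | e m i) (c i - d i) * x i).
  under eq_bigr => k _ do rewrite mulrBl.
  by rewrite sumrB e1 addrAC subrr add0r.
rewrite -big_filter -[X in _ -> _ X]big_filter.
apply: clique_xy_var; first by rewrite filter_uniq // index_enum_uniq.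
exact: filter_all.
Qed.

(** Write [x_m q] as the sum of the [c_i f_im] plus [g] in the ideal of [G - m], and put [x_m] to 0.
    As [y_m] is regular modulo that ideal, the sum of the [c_i x_i] at [x_m = 0] lies in it, and by
    [clique_xy] so does that of the [c_i y_i]. *)
Lemma clique_regular q : edge_ideal e [::] ('X_(lshift n m) * q) -> edge_ideal e [::] q.
Proof.
have dec p : edge_ideal e [::] p -> exists c g, edge_ideal (del e m) [::] g /\
    p = \sum_(i | e m i) c i * f i m + g.
  elim=> [|a b _ [da [ha [h1 ->]]] _ [db [hb [k1 ->]]]|c i j eij|//].
  - by exists (fun=> 0), 0; split; [exact: edge_ideal0 | rewrite addr0 big1 // => i _; rewrite mul0r].
  - exists (fun i => da i + db i), (ha + hb); split; first exact: edge_idealD.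
    under [in RHS]eq_bigr => i _ do rewrite mulrDl.
    by rewrite big_split /= addrACA.
  - have [im|im] := eqVneq i m.
      exists (fun k => if k == j then - c else 0), 0; split; first exact: edge_ideal0.
      by rewrite sum_delta -?im // addr0 fbinC; ring.
    have [jm|jm] := eqVneq j m.
      exists (fun k => if k == i then c else 0), 0; split; first exact: edge_ideal0.
      by rewrite sum_delta ?addr0 -?jm // esym.
    exists (fun=> 0), (c * f i j); split; first by apply: edge_idealf; rewrite /del eij im jm.
    by rewrite big1 ?add0r // => k _; rewrite mul0r.
move=> /dec[c [g [shomog eq0]]].
have [fx fy] := del_freevar K m e.
have /fin_all_exists[c' hc'] i : exists c', c i = zeta (lshift n m) (c i) + c' * x m.
  exact: zeta_dec.
pose zc i := zeta (lshift n m) (c i).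
pose lam (a : 'I_n -> R) := \sum_(i | e m i) a i * x i.
pose nu (a : 'I_n -> R) := \sum_(i | e m i) a i * y i.
have mu a : \sum_(i | e m i) a i * f i m = y m * lam a - x m * nu a.
  rewrite /lam /nu !mulr_sumr -sumrB; apply: eq_bigr => i _; rewrite /fbin; ring.
have elam : lam c = lam zc + x m * lam c'.
  rewrite /lam mulr_sumr -big_split; apply: eq_bigr => i _ /=.
  by rewrite {1}hc' /zc; ring.
have enu : nu c = nu zc + x m * nu c'.
  rewrite /nu mulr_sumr -big_split; apply: eq_bigr => i _ /=.
  by rewrite {1}hc' /zc; ring.
have nem i : e m i -> (i == m) = false.
  by apply: contraTF => /eqP ->; rewrite eirr.
have zlam : zeta (lshift n m) (lam c) = lam zc.
  rewrite /lam zeta_sum; apply: eq_bigr => i /nem im.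
  by rewrite zetaM zeta_x im.
have hl : edge_ideal (del e m) [::] (lam zc).
  apply: (edge_ideal_regular fy) => //.
  have := congr1 (zeta (lshift n m)) eq0.
  rewrite mu zetaM zetaX eqxx mul0r zetaD zetaB !zetaM zeta_x zeta_y zlam eqxx.
  rewrite mul0r subr0 => /eqP; rewrite eq_sym addr_eq0 => /eqP ->.
  by apply: idealN (edge_ideal_ideal _ _ _) _; apply: zeta_edge_ideal_nil shomog _.
have hn := clique_xy hl.
(* The correction to [q] gathers all multiples of [x_m] on one side, where [x_m] cancels modulo the
   ideal of [G - m]. *)
have hq : edge_ideal (del e m) [::] (q + nu c - y m * lam c').
  apply: (edge_ideal_regular fx) => //.
  rewrite (_ : _ * _ = y m * lam zc + g); last first.
    rewrite -/(xv K m) mulrBr mulrDr; move: eq0; rewrite -/(xv K m) mu => ->.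
    by rewrite elam; ring.
  by apply: edge_idealD => //; apply: idealM (edge_ideal_ideal _ _ _) _ _ hl.
have -> : q = (q + nu c - y m * lam c') - nu zc + \sum_(i | e m i) c' i * f i m.
  by rewrite mu enu; ring.
apply: edge_idealD.
  by apply: edge_ideal_mono (idealB (edge_ideal_ideal _ _ _) hq hn) => // i j; exact: del_e.
apply: big_ind => [||i ei]; [exact: edge_ideal0 | exact: edge_idealD | ].
by apply: edge_idealf; rewrite esym.
Qed.

Definition xC : seq 'I_(n + n) := [seq lshift n i | i <- enum 'I_n & C i].

Lemma xCP i : C i -> lshift n i \in xC.
Proof. by move=> Ci; rewrite /xC map_f // mem_filter Ci mem_enum. Qed.

Lemma e_xC i j : e i j -> edge_ideal eC xC (f i j).
Proof.
move=> eij; have [Ci|nCi] := boolP (C i).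
  by apply: edge_ideal_f_xx; apply: xCP => //; exact: comp_closed Ci.
apply: edge_ideal_gen; rewrite /del_comp eij nCi /=; apply: contra nCi.
by apply: comp_closed; rewrite esym.
Qed.

Lemma Cm : C m. Proof. by rewrite /C eqxx. Qed.

(** Modulo [x_m] the binomial [f_im] becomes [x_i y_m], so [y_m] multiplies the second ideal into
    [J_G + (x_m)]. An element of both is, up to [J_G + (x_m)], some [y_m q'], and regularity of
    [y_m] modulo the second ideal puts [q'] there. *)
Lemma clique_cap p :
  edge_ideal (del e m) (xy m) p /\ edge_ideal eC xC p <-> edge_ideal e [:: lshift n m] p.
Proof.
have [fx fy] := eC_freevar Cm.
have yNxC : rshift n m \notin xC.
  by apply/negP => /mapP[i _ /eqP]; rewrite eq_rlshift.
split=> [[/edge_ideal_cons[u [q [/edge_ideal_cons[u' [q' [hu' ->]]] ->]]] h]|h]; last first.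
  split; apply: edge_ideal_sub h; try exact: edge_ideal_ideal.
  - move=> i j eij; have [->|im] := eqVneq i m.
      by apply: edge_ideal_f_in; rewrite !inE eqxx ?orbT.
    have [->|jm] := eqVneq j m; first by apply: edge_ideal_f_in2; rewrite !inE eqxx ?orbT.
    by apply: edge_ideal_gen; rewrite /del eij im jm.
  - by move=> z; rewrite inE => /eqP ->; apply: edge_ideal_var; rewrite inE eqxx.
  - exact: e_xC.
  - by move=> z; rewrite inE => /eqP ->; apply: edge_ideal_var; apply: xCP Cm.
have hq' : edge_ideal eC xC q'.
  apply: (edge_ideal_regular fy yNxC).
  rewrite (_ : _ * _ = (u' + 'X_(rshift n m) * q' + 'X_(lshift n m) * q)
     - u' - 'X_(lshift n m) * q); last by ring.
  apply: idealB (edge_ideal_ideal _ _ _) _ _; last by rewrite mulrC; apply: edge_idealx; apply: xCP Cm.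
  apply: idealB (edge_ideal_ideal _ _ _) h _.
  by apply: edge_ideal_sub (edge_ideal_ideal _ _ _) _ _ hu' => // i j /del_e; exact: e_xC.
apply: edge_idealD; last by rewrite mulrC; apply: edge_idealx; rewrite inE.
apply: edge_idealD; first by apply: edge_ideal_mono hu' => // i j; exact: del_e.
apply: (@edge_ideal_sub _ _ _ _ (fun c => edge_ideal e [:: lshift n m] ('X_(rshift n m) * c)) _ _ _ _ hq').
- split=> [|a b ha hb|c a ha]; first by rewrite mulr0; exact: edge_ideal0.
    by rewrite mulrDr; exact: edge_idealD.
  by rewrite mulrCA; apply: idealM (edge_ideal_ideal _ _ _) _ _ ha.
- by move=> i j /eC_e eij; apply: edge_idealf.
- move=> z /mapP[i]; rewrite mem_filter => /andP[Ci _] ->.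
  move: Ci; rewrite /C => /orP[/eqP->|emi]; first by apply: edge_idealx; rewrite inE.
  rewrite (_ : _ * _ = 1 * f i m + y i * 'X_(lshift n m)).
    by apply: edge_idealD; [apply: edge_idealf; rewrite esym | apply: edge_idealx; rewrite inE].
  by rewrite /fbin /xv /yv; ring.
Qed.

Lemma clique_sum p :
  (exists p1 p2, [/\ edge_ideal (del e m) (xy m) p1, edge_ideal eC xC p2 & p = p1 + p2])
  <-> edge_ideal eC (rshift n m :: xC) p.
Proof.
split=> [[p1 [p2 [h1 h2 ->]]]|/edge_ideal_cons[u [q [hu ->]]]]; last first.
  exists ('X_(rshift n m) * q), u; split=> //; last by rewrite addrC.
  by rewrite mulrC; apply: edge_idealx; rewrite !inE eqxx orbT.
have sub z : z \in xC -> z \in rshift n m :: xC by move=> h; rewrite inE h orbT.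
apply: edge_idealD; last by apply: edge_ideal_mono h2.
apply: edge_ideal_sub h1; first exact: edge_ideal_ideal.
  by move=> i j /del_e /e_xC; apply: edge_ideal_mono.
move=> z; rewrite !inE => /orP[]/eqP->; apply: edge_ideal_var; last by rewrite inE eqxx.
by apply: sub; apply: xCP Cm.
Qed.

Lemma reg_le_clique r : (0 < r)%N ->
  reg_le (edge_ideal (del e m) [::]) r.+1 -> reg_le (edge_ideal eC [::]) r -> reg_le (edge_ideal e [::]) r.+1.
Proof.
move=> r0 g1 g2.
have fC z : z \in rshift n m :: xC -> freevar K eC z.
  rewrite inE => /orP[/eqP ->|/mapP[i]]; first by case: (eC_freevar Cm).
  by rewrite mem_filter => /andP[/eC_freevar[h _] _] ->.
apply: (@reg_le_regular _ _ _ (lshift n m)); first exact: edge_ideal_gideal.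
  exact: clique_regular.
apply: (reg_le_ext (edge_ideal_cons e [::] (lshift n m))).
apply: (reg_le_ext clique_cap).
apply: reg_le_cap; try exact: edge_ideal_gideal.
- exact: reg_le_xy.
- apply: reg_le_vars => // [z hz|]; first by apply: fC; rewrite inE hz orbT.
  exact: reg_le_mono g2.
- by apply: (reg_le_ext (fun p => iff_sym (clique_sum p))); apply: reg_le_vars.
Qed.

End Cliques.

(** * Induction on the graph *)

Section Graphs.
Variables (K : fieldType) (n : nat).
Implicit Types (e : rel 'I_n) (W : {set 'I_n}).
Local Notation edge_ideal := (@edge_ideal K n).

Lemma reg_le_noedge e r : (forall i j, e i j = false) -> reg_le (edge_ideal e [::]) r.
Proof.
move=> h; apply: reg_le_zero => p; split=> [|->]; last exact: edge_ideal0.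
elim=> [|a b _ -> _ ->|c i j|] //; by rewrite ?addr0 ?h.
Qed.

Lemma edge_dec e : (forall i j, e i j = false) \/ exists i j, e i j.
Proof.
case: (boolP [exists i, exists j, e i j]) => [/existsP[i /existsP[j eij]]|h].
  by right; exists i, j.
left=> i j; apply: contraNF h => eij; apply/existsP; exists i.
by apply/existsP; exists j.
Qed.

(** Isolating the component of [m] removes at least [m] and its neighbour [j] from [W], which pays
    for lowering [r] by one. *)
Lemma reg_le_cliques e W r : simple_graph e -> cliques e ->
  (forall i j, e i j -> i \in W) -> (0 < r)%N -> (#|W| < r.*2)%N ->
  reg_le (edge_ideal e [::]) r.
Proof.
have [k] := ubnP #|W|; elim: k e W r => // k IH e W r hk [eirr esym] ecl eW r0 hr.
have [/reg_le_noedge //|[m [j emj]]] := edge_dec e.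
have mj : j != m by apply: contraTneq emj => ->; rewrite eirr.
have mW := eW _ _ emj.
have jW : j \in W :\ m by rewrite !inE mj (eW j m) // esym.
have c1 : #|W| = #|W :\ m|.+1 by rewrite (cardsD1 m W) mW.
have c2 : #|W :\ m| = #|W :\ m :\ j|.+1 by rewrite (cardsD1 j (W :\ m)) jW.
case: r r0 hr => // r _ hr.

apply: (@reg_le_clique _ _ e m) => //.
  by lia.
- apply: (IH _ (W :\ m)) => //; try by lia.
  + split=> [i|u v]; first by rewrite /del eirr.
    by rewrite /del esym; case: (e v u) => //=; rewrite andbC.
  + move=> u v w /and3P[e1 h1 _] /and3P[e2 _ h2] uw.
    by rewrite /del (ecl _ _ _ e1 e2 uw) h1 h2.
  + by move=> u v /and3P[/eW h1 h2 _]; rewrite !inE h2.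
- apply: (IH _ ((W :\ m) :\ j)); try by lia.
  + split=> [i|u v]; first by rewrite /del_comp eirr.
    by rewrite /del_comp esym; case: (e v u) => //=; rewrite andbC.
  + move=> u v w /and3P[e1 h1 _] /and3P[e2 _ h2] uw.
    by rewrite /del_comp (ecl _ _ _ e1 e2 uw) h1 h2.
  + move=> u v /and3P[/eW h1]; rewrite negb_or => /andP[h2 h3] _.
    by rewrite !inE h1 h2 !andbT; apply: contraNneq h3 => ->.
Qed.

(** * Inserting a vertex into a path *)

Lemma bump_adjacent_gap (h c : nat) : h = c.+1 -> forall k,
  ((h.+1 == bump h k) || ((bump h k).+1 == h))%N = (k == c) || (k == h).
Proof. by move=> -> k; rewrite /bump; case: ltnP; lia. Qed.

(** Opening a gap at [h] destroys only the adjacency of [c] and [h], between which the new vertex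
    goes. *)
Lemma bump_adjacent (h c : nat) : h = c.+1 -> forall k l,
  ((bump h k).+1 == bump h l) || ((bump h l).+1 == bump h k)
  = [&& (k.+1 == l) || (l.+1 == k), ~~ ((k == c) && (l == h)) & ~~ ((l == c) && (k == h))].
Proof. by move=> -> k l; rewrite /bump; case: ltnP; case: ltnP; lia. Qed.

(** The hypotheses contradict each other, as no number is adjacent to two consecutive ones; the
    conclusion has the form to which injectivity of a numbering applies. *)
Lemma adjacent_common (k c h : nat) : h = c.+1 -> (k.+1 == c) || (c.+1 == k) ->
  (k.+1 == h) || (h.+1 == k) -> k = h.
Proof. lia. Qed.

Lemma no_adjacent_triangle (k c h : nat) : true = (k.+1 == c) || (c.+1 == k) ->
  true = (k.+1 == h) || (h.+1 == k) -> true = (c.+1 == h) || (h.+1 == c) -> False.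
Proof. lia. Qed.

(** Only the values of [p] on [W] matter, so deleted vertices need no position. *)
Definition path_on W e := exists p : 'I_n -> nat,
  [/\ forall u, u \in W -> (p u < #|W|)%N, {in W &, injective p} &
      forall u v, u \in W -> v \in W -> e u v = ((p u).+1 == p v) || ((p v).+1 == p u)].

(** In the path [G_v - v] the neighbours [a], [b] of [v] are consecutive, and a third neighbour
    would complete a triangle. As [ab] is not an edge of [G], inserting [v] between them numbers [G]
    as a path. *)
Lemma path_cone_ex e W v a b : simple_graph e -> (forall i j, e i j -> i \in W) ->
  e v a -> e v b -> a != b -> ~~ e a b ->
  path_on (W :\ v) (del (cone e v) v) -> path_on W e.
Proof.
move=> [eirr esym] eW eva evb ab nab [p [pb pinj pe]].
wlog pab : a b eva evb ab nab / p b = (p a).+1.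
  move=> hw.
  have : del (cone e v) v a b.
    rewrite /del /cone eva evb ab orbT /=.
    by apply/andP; split; [apply: contraTneq eva | apply: contraTneq evb] => ->;
       rewrite eirr.
  have nbr c : e v c -> c \in W :\ v.
    move=> evc; rewrite !inE (eW c v) 1?esym // andbT.
    by apply: contraTneq evc => ->; rewrite eirr.
  rewrite pe ?nbr // => /orP[/eqP h|/eqP h]; first exact: (hw a b).
  by apply: (hw b a); rewrite // 1?eq_sym // esym.
have nbrW c : e v c -> c \in W :\ v.
  move=> evc; rewrite !inE (eW c v) 1?esym // andbT.
  by apply: contraTneq evc => ->; rewrite eirr.
have aW := nbrW a eva; have bW := nbrW b evb.
have vW : v \in W by apply: eW eva.
have card : #|W| = #|W :\ v|.+1 by rewrite (cardsD1 v W) vW.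
have nbr c : c \in W :\ v -> e v c = (c == a) || (c == b).
  move=> cW; apply/idP/idP => [evc|/orP[]/eqP->//].
  have [//|ca] := eqVneq c a; have [//|cb] := eqVneq c b.
  have cv : c != v by move: cW; rewrite !inE => /andP[].
  have av : a != v by move: aW; rewrite !inE => /andP[].
  have bv : b != v by move: bW; rewrite !inE => /andP[].
  have h1 : del (cone e v) v c a by rewrite /del /cone evc eva ca cv av orbT.
  have h2 : del (cone e v) v c b by rewrite /del /cone evc evb cb cv bv orbT.
  rewrite pe // in h1; rewrite pe // in h2.
  by have /(pinj _ _ cW bW)/eqP := adjacent_common pab h1 h2; rewrite (negPf cb).
have pa_eq c : c \in W :\ v -> (p c == p a) = (c == a).
  by move=> cW; apply/eqP/eqP => [|->//]; exact: pinj.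
have pb_eq c : c \in W :\ v -> (p c == p b) = (c == b).
  by move=> cW; apply/eqP/eqP => [|->//]; exact: pinj.
(* [v] takes the position of [b]; [b] and everything beyond it move up by one. *)
pose q u := if u == v then p b else bump (p b) (p u).
have inW u : u \in W -> u != v -> u \in W :\ v by rewrite !inE => -> ->.
have qvE : q v = p b by rewrite /q eqxx.
have qE u : u != v -> q u = bump (p b) (p u) by rewrite /q => /negPf ->.
have ev u : u \in W -> u != v -> e v u = ((q v).+1 == q u) || ((q u).+1 == q v).
  move=> uW uv; have uW' := inW _ uW uv.
  by rewrite qvE qE // (bump_adjacent_gap pab) pa_eq // pb_eq // nbr.
have qb k : (k < #|W :\ v|)%N -> (bump (p b) k < #|W|)%N.
  by rewrite card /bump; case: (p b <= k)%N => kW //; exact: ltnW.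
exists q; split.
- move=> u uW; have [->|uv] := eqVneq u v.
    by rewrite qvE card; apply: ltnW; rewrite ltnS; exact: pb.
  by rewrite qE //; apply: qb; apply: pb; exact: inW.
- move=> u w uW wW; have [->|uv] := eqVneq u v; have [->//|wv] := eqVneq w v.
  + by rewrite qvE qE // => /eqP; rewrite (negPf (neq_bump _ _)).
  + by rewrite qvE qE // => /eqP; rewrite eq_sym (negPf (neq_bump _ _)).
  + by rewrite !qE // => /(can_inj (bumpK _)); apply: pinj; exact: inW.
- move=> u w uW wW; have [->|uv] := eqVneq u v; have [->|wv] := eqVneq w v.
  + by rewrite eirr eqn_leq ltnn.
  + exact: ev.
  + by rewrite esym orbC; exact: ev.
  + have uW' := inW _ uW uv; have wW' := inW _ wW wv.
    rewrite !qE // (bump_adjacent pab) -pe // !pa_eq // !pb_eq //.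
    rewrite /del /cone uv wv !andbT !nbr //.
    (* Away from [v] the two graphs differ only in the edge [ab], the pair separated by the gap. *)
    have nba : e b a = false by rewrite esym; exact: negPf.
    have [->|ua] := eqVneq u a; have [->|wa] := eqVneq w a;
    rewrite ?(negPf ab) ?[b == a]eq_sym ?(negPf ab) ?eqxx ?eirr //=.
    * by have [->|wb] := eqVneq w b; rewrite ?(negPf nab) ?orbF ?andbT ?andbF.
    * by have [->|ub] := eqVneq u b; rewrite ?nba ?orbF ?andbT ?andbF.
    * have [->|ub] := eqVneq u b; have [->|wb] := eqVneq w b;
        by rewrite ?eirr ?eqxx ?andbF ?orbF ?andbT.
Qed.

Lemma cone_triangle e W v a b : simple_graph e -> (forall i j, e i j -> i \in W) ->
  e v a -> e v b -> a != b -> ~ path_on W (cone e v).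
Proof.
move=> [eirr esym] eW eva evb ab [p [_ pinj pe]].
have vW := eW _ _ eva.
have aW : a \in W by apply: (eW a v); rewrite esym.
have bW : b \in W by apply: (eW b v); rewrite esym.
have h1 := pe v a vW aW; have h2 := pe v b vW bW; have h3 := pe a b aW bW.
move: h1 h2 h3; rewrite /cone eva evb ab orbT /=.
exact: no_adjacent_triangle.
Qed.

Lemma simple_del e v : simple_graph e -> simple_graph (del e v).
Proof.
move=> [eirr esym]; split=> [i|i j]; first by rewrite /del eirr.
by rewrite /del esym; case: (e j i) => //=; rewrite andbC.
Qed.

Lemma simple_cone e v : simple_graph e -> simple_graph (cone e v).
Proof.
move=> [eirr esym]; split=> [i|i j]; first by rewrite /cone eirr eqxx !andbF.
by rewrite /cone esym eq_sym; congr (_ || _); rewrite !andbA [e v i && _]andbC.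
Qed.

(** The outer induction is on the size of [W], the inner on the number of non-edges: passing to
    [cone e v] gains the edge [ab] and keeps [W], while deleting [v] shrinks [W]. *)
Lemma reg_le_graph e W : simple_graph e -> (forall i j, e i j -> i \in W) ->
  (1 < #|W|)%N ->
  reg_le (edge_ideal e [::]) #|W| /\ (~ path_on W e -> reg_le (edge_ideal e [::]) #|W|.-1).
Proof.
have [k] := ubnP #|W|; elim: k e W => // k IHk e W.
have [l] := ubnP #|[set p : 'I_n * 'I_n | ~~ e p.1 p.2]|.
elim: l e => // l IHl e hl hk es eW W1; have [eirr esym] := es.
case: (boolP [exists v, exists a, exists b,
    [&& e v a, e v b, a != b & ~~ e a b]]) => [|hfree]; last first.
  have ecl : cliques e.
    move=> u v w euv evw uw; apply: contraNT hfree => nuw.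
    apply/existsP; exists v; apply/existsP; exists u; apply/existsP; exists w.
    by rewrite esym euv evw uw nuw.
  split; first by apply: (reg_le_cliques es ecl eW); lia.
  (* Beyond two vertices the estimate for cliques already gives [#|W|.-1]; on two vertices a graph
     with an edge is a path. *)
  move=> np; case: (ltnP 2 #|W|) => W2; first by apply: (reg_le_cliques es ecl eW); lia.
  have [/reg_le_noedge //|[u [v euv]]] := edge_dec e.
  case: np.
  have uW := eW _ _ euv; have vW : v \in W by apply: (eW v u); rewrite esym.
  have uv : v != u by apply: contraTneq euv => ->; rewrite eirr.
  have c1 : #|W| = #|W :\ u|.+1 by rewrite (cardsD1 u W) uW.
  have c2 : #|W :\ u| = #|W :\ u :\ v|.+1.
    by rewrite (cardsD1 v (W :\ u)) !inE uv vW.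
  have hW w : w \in W -> w = u \/ w = v.
    move=> wW; have [|wu] := eqVneq w u; first by left.
    have [|wv] := eqVneq w v; first by right.
    suff : (0 < #|W :\ u :\ v|)%N by lia.
    by rewrite (cardsD1 w (W :\ u :\ v)) !inE wu wv wW.
  have uv' : (u == v) = false by rewrite eq_sym (negPf uv).
  exists (fun w => (w == v) : nat); split.
  - by move=> w _; case: eqP => _; lia.
  - by move=> w w' /hW[->|->] /hW[->|->]; rewrite ?eqxx ?uv'.
  - by move=> w w' /hW[->|->] /hW[->|->]; rewrite ?eqxx ?uv' ?eirr ?euv // esym euv.
case/existsP=> v /existsP[a /existsP[b /and4P[eva evb ab nab]]].
have vW := eW _ _ eva.
have aW : a \in W :\ v.
  by rewrite !inE (eW a v) 1?esym // andbT; apply: contraTneq eva => ->; rewrite eirr.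
have bW : b \in (W :\ v) :\ a.
  rewrite !inE (eW b v) 1?esym // andbT eq_sym ab /=.
  by apply: contraTneq evb => ->; rewrite eirr.
have c1 : #|W| = #|W :\ v|.+1 by rewrite (cardsD1 v W) vW.
have c2 : #|W :\ v| = #|W :\ v :\ a|.+1 by rewrite (cardsD1 a (W :\ v)) aW.
have c3 : #|W :\ v :\ a| = #|W :\ v :\ a :\ b|.+1.
  by rewrite (cardsD1 b (W :\ v :\ a)) bW.
have coneW i j : cone e v i j -> i \in W.
  by case/orP=> [/eW //|/and3P[h _ _]]; apply: (eW i v); rewrite esym.
have delW e' : (forall i j, e' i j -> i \in W) -> forall i j, del e' v i j -> i \in W :\ v.
  by move=> h i j /and3P[/h h1 h2 _]; rewrite !inE h2.
have [_ g1] : reg_le (edge_ideal (cone e v) [::]) #|W| /\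
    (~ path_on W (cone e v) -> reg_le (edge_ideal (cone e v) [::]) #|W|.-1).
  apply: IHl => //; last exact: simple_cone.
  rewrite -ltnS; apply: leq_trans hl; rewrite ltnS; apply: proper_card; apply/properP; split.
    by apply/subsetP=> -[i j]; rewrite !inE /cone /= negb_or => /andP[].
  by exists (a, b); rewrite !inE /= ?nab // /cone eva evb ab orbT.
have {}g1 := g1 (cone_triangle es eW eva evb ab).
have [g2 _] : reg_le (edge_ideal (del e v) [::]) #|W :\ v| /\
    (~ path_on (W :\ v) (del e v) -> reg_le (edge_ideal (del e v) [::]) #|W :\ v|.-1).
  by apply: IHk; [lia | exact: simple_del | exact: delW | lia].
have [g3 g3'] : reg_le (edge_ideal (del (cone e v) v) [::]) #|W :\ v| /\
    (~ path_on (W :\ v) (del (cone e v) v) ->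
     reg_le (edge_ideal (del (cone e v) v) [::]) #|W :\ v|.-1).
  apply: IHk; [lia | exact/simple_del/simple_cone | exact: delW | lia].
move: g1 g2 g3 g3'; rewrite c1 c2 /= => g1 g2 g3 g3'.
split=> [|np]; apply: (reg_le_ohtani eirr) => //.
- exact: reg_le_mono g1.
- exact: reg_le_mono g2.
- by rewrite c3.
- by apply: g3' => /(path_cone_ex es eW eva evb ab nab).
Qed.

Lemma path_onT e : path_on [set: 'I_n] e -> is_path_graph e.
Proof.
case=> p [pb pinj pe].
have pb' u : (p u < n)%N by have := pb u (in_setT u); rewrite cardsT card_ord.
have sinj : injective (fun u => Ordinal (pb' u)).
  by move=> u v /(congr1 val) /= /pinj ->.
by exists (perm sinj) => u v; rewrite !permE /= pe.
Qed.

Lemma reg_le_nonpath e : simple_graph e -> ~ is_path_graph e ->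
  reg_le (edge_ideal e [::]) n.-1 /\ (1 < n)%N.
Proof.
move=> es np; have n1 : (1 < n)%N.
  (* A graph on at most one vertex is a path. *)
  rewrite ltnNge; apply/negP => n1; apply: np; exists 1%g => u v.
  have -> : u = v by apply: val_inj => /=; have := ltn_ord u; have := ltn_ord v; lia.
  by case: es => -> _; rewrite !perm1; lia.
split=> //; have := @reg_le_graph e [set: 'I_n] es; rewrite cardsT card_ord.
by move=> /(_ (fun _ _ _ => in_setT _) n1)[_]; apply => /path_onT.
Qed.

End Graphs.

(** * Minimal resolutions *)

Section MinimalGenerators.
Variables (K : fieldType) (N : nat).
Local Notation R := {mpoly K[N]}.

Lemma ex_min (P : nat -> Prop) t : P t -> exists2 s, P s & forall s', (s' < s)%N -> ~ P s'.
Proof.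
elim/ltn_ind: t => t IH Pt.
case: (classic (exists2 s, (s < t)%N & P s)) => [[s st Ps]|h]; first exact: IH Ps.
by exists t => // s st Ps; apply: h; exists s.
Qed.

(** Among homogeneous generating families of degrees at most [r], take one with fewest members. A
    syzygy with a non-zero constant term at [i] would express generator [i] through the others. *)
Lemma minimal_generators m (d : 'I_m -> nat) (M : 'rV[R]_m -> Prop) r :
  (forall k, reg_upto k d M r) ->
  exists t (dd : 'I_t -> nat) (g : 'M[R]_(t, m)),
    [/\ mxhomog dd d g, forall i, (dd i <= r)%N, forall v, M v <-> exists a, v = a *m g,
        forall a : 'rV_t, a *m g = 0 -> forall i, (a 0 i)@_0%MM = 0
      & forall k, reg_upto k dd (fun a => a *m g = 0) r.+1].
Proof.
move=> hG; pose gens t := exists (dd : 'I_t -> nat) (g : 'M[R]_(t, m)),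
  [/\ mxhomog dd d g, forall i, (dd i <= r)%N & forall v, M v <-> exists a, v = a *m g].
have [t0 gt0] : exists t, gens t.
  by have [t [dd [g [h1 h2 h3 _]]]] := hG 1%N; exists t, dd, g.
have [t [dd [g [h1 h2 h3]]] tmin] := ex_min gt0.
exists t, dd, g; split=> // [a ag i|k]; last first.
  by apply: reg_upto_indep (hG k.+1) h1 _ h3 => i; exact: leqW.
apply/eqP/negPn/negP => /eqP c0; set c := (a 0 i)@_0%MM in c0.
have t0' : (0 < t)%N by case: (t) i {c c0} => [[]|].
apply: (tmin t.-1); first by rewrite prednK.
pose a' := rvcomp dd (dd i) a.
have a'g : a' *m g = 0 by rewrite -(rvcomp_mul _ _ h1) ag rvcomp0.
(* In the component of degree [dd i], the coordinate at [i] has polynomial degree 0. *)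
have a'i : a' 0 i = c%:MP.
  rewrite mxE; apply/mpolyP => u; rewrite mcoeff_hcomp mcoeffC -{2}[dd i]add0n eqn_add2r.
  by rewrite mdeg_eq0; case: eqP => [->|_]; rewrite ?mulr1 ?mulr0.
clearbody a'; exists (dd \o lift i), (row' i g); split=> [k j|k|v].
- by rewrite mxE; exact: h1.
- exact: h2.
have col_row (b : 'rV[R]_t) : b 0 i = 0 -> b *m g = col' i b *m row' i g.
  move=> bi; apply/rowP => j; rewrite !mxE (bigD1_ord i) //= bi mul0r add0r.
  by apply: eq_bigr => k _; rewrite !mxE.
split=> [/h3[b ->]|[b ->]].
  pose b' := b - (b 0 i * (c^-1)%:MP) *: a'.
  exists (col' i b'); rewrite -col_row.
    by rewrite mulmxBl -scalemxAl a'g scaler0 subr0.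
  rewrite !mxE a'i -mulrA -mpolyCM mulVf ?mpolyC1 ?mulr1 ?subrr //.
  exact/eqP.
apply/h3; pose b' : 'rV[R]_t := \row_j oapp (fun k => b 0 k) 0 (unlift i j).
exists b'; rewrite col_row; last by rewrite mxE unlift_none.
by congr (_ *m _); apply/rowP => j; rewrite !mxE liftK.
Qed.

(** One module of the iterated syzygies with its bound, bundled because rank and degrees change
    along the resolution. *)
Record stage := Stage {
  sm : nat; sd : 'I_sm -> nat; sM : 'rV[R]_sm -> Prop; sr : nat;
  sG : forall k, reg_upto k sd sM sr }.

Record cover (s : stage) := Cover {
  ct : nat; cd : 'I_ct -> nat; cg : 'M[R]_(ct, sm s);
  cover_homog : mxhomog cd (@sd s) cg;
  cover_le : forall i, (cd i <= sr s)%N;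
  cover_gen : forall v, sM v <-> exists a, v = a *m cg;
  cover_min : forall a : 'rV_ct, a *m cg = 0 -> forall i, (a 0 i)@_0%MM = 0;
  cover_G : forall k, reg_upto k cd (fun a => a *m cg = 0) (sr s).+1 }.

Lemma cover_ex (s : stage) : exists c : cover s, True.
Proof.
have [t [dd [g [h1 h2 h3 h4 h5]]]] := minimal_generators (@sG s).
by exists (Cover h1 h2 h3 h4 h5).
Qed.

Definition min_cover (s : stage) : cover s :=
  proj1_sig (constructive_indefinite_description _ (cover_ex s)).

Fixpoint resolution (s0 : stage) i : stage :=
  if i is i'.+1 then Stage (cover_G (min_cover (resolution s0 i'))) else s0.

Lemma resolution_sr s0 i : sr (resolution s0 i) = (sr s0 + i)%N.
Proof. by elim: i => [|i IH]; rewrite ?addn0 //= IH addnS. Qed.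

(** When [b < a] the subtraction is truncated, but then [p] is zero, homogeneous of every degree. *)
Lemma shomog_dhomog a b (p : R) : shomog a b p -> p \is (b - a)%N.-homog.
Proof. by move=> h; apply/dhomogP => u /h <-; rewrite /= addnK. Qed.

End MinimalGenerators.

(** * From the regularity bound to a minimal resolution of the binomial edge ideal *)

Lemma in_JG_edge_ideal (K : fieldType) n (e : rel 'I_n) p : simple_graph e ->
  in_JG e p <-> @edge_ideal K n e [::] p.
Proof.
move=> [eirr esym]; split=> [[c ->]|].
  apply: big_ind => [||i _]; [exact: edge_ideal0 | exact: edge_idealD | ].
  apply: big_ind => [||j /andP[eij _]]; [exact: edge_ideal0 | exact: edge_idealD | exact: edge_idealf].
elim=> [|a b _ [ca ->] _ [cb ->]|c i j eij|//].
- exists (fun _ _ => 0); rewrite big1 // => i _; rewrite big1 // => j _.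
  by rewrite mul0r.
- exists (fun i j => ca i j + cb i j); rewrite -big_split; apply: eq_bigr => i _ /=.
  by rewrite -big_split; apply: eq_bigr => j _; rewrite mulrDl.
have delta (c' : S K n) k l : e k l -> (k < l)%N -> in_JG e (c' * fbin K k l).
  move=> ekl kl; exists (fun i j => if (i == k) && (j == l) then c' else 0).
  rewrite (bigD1 k) //= (bigD1 l) ?ekl //= !eqxx big1 ?addr0; last first.
    by move=> j' /andP[_ /negPf ->]; rewrite mul0r.
  rewrite big1 ?addr0 // => i' /negPf ->; rewrite big1 // => j' _.
  by rewrite mul0r.
have := ltngtP i j; case=> [ij|ji|/val_inj ij].
- exact: delta.
- by rewrite fbinC mulrN -mulNr; apply: delta; rewrite // esym.
- by rewrite ij eirr in eij.
Qed.

(** Exactness holds because each stage is the syzygy module of the preceding cover; the bound grows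
    by one per stage, as [d i k - i] allows. *)
Lemma reg_JG_le_of_reg_le (K : fieldType) n (e : rel 'I_n) r : simple_graph e ->
  reg_le (@edge_ideal K n e [::]) r -> reg_JG_le K e r%:Z.
Proof.
move=> es hG; pose s0 := Stage hG.
pose st := resolution s0; pose cv i := min_cover (st i).
exists (fun i => ct (cv i)), (fun i => @cd _ _ _ (cv i)).
exists (fun k => @cg _ _ _ (cv 0%N) k ord0), (fun i => @cg _ _ _ (cv i.+1)).
have row_syz i k : row k (cg (cv i.+1)) *m cg (cv i) = 0.
  by apply/(cover_gen (cv i.+1)); exists (delta_mx 0 k); rewrite rowE.
split; [split; split | ].
- move=> k; have := shomog_dhomog (@cover_homog _ _ _ (cv 0%N) k ord0).
  by rewrite subn0.
- by move=> i k c; apply: shomog_dhomog (@cover_homog _ _ _ (cv i.+1) k c).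
- move=> i k c; rewrite -msupp_eq0.
  (* A non-zero entry has a monomial, which is not constant because the rows are syzygies of minimal
     generators. *)
  case E: (msupp _) => [//|u l] _.
  have hu : u \in msupp (cg (cv i.+1) k c) by rewrite E mem_head.
  have := @cover_homog _ _ _ (cv i.+1) k c _ hu.
  have : u != 0%MM.
    apply: contraTneq hu => ->; rewrite mcoeff_msupp negbK.
    by have := cover_min (row_syz i k) c; rewrite mxE => ->.
  rewrite -mdeg_eq0 -lt0n => u0 <-; rewrite -[X in (X < _)%N]add0n ltn_add2r //.
- move=> p; rewrite (in_JG_edge_ideal p es).
  have := cover_gen (cv 0%N) (p%:M).
  rewrite /= /rowJ mxE eqxx mulr1n => ->.
  split=> [[a ea]|[v ->]].
    by exists a; have := congr1 (fun w : 'rV_1 => w 0 0) ea; rewrite !mxE eqxx mulr1n.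
  by exists v; apply/rowP => i; rewrite (ord1 i) !mxE eqxx mulr1n.
- move=> v; rewrite -(cover_gen (cv 1%N) v) /=.
  split=> [h|/(congr1 (fun w : 'rV_1 => w 0 0))]; last by rewrite !mxE.
  by apply/rowP => i; rewrite ord1 !mxE.
- by move=> i v; rewrite -(cover_gen (cv i.+2) v).
- move=> i k; have := @cover_le _ _ _ (cv i) k; rewrite resolution_sr /=; lia.
Qed.

Theorem theorem3p4 (K : fieldType) (n : nat) (e : rel 'I_n) :
  simple_graph e -> ~ is_path_graph e ->
  reg_JG_le K e (n%:Z - 1).
Proof.
move=> es np; have [g n1] := reg_le_nonpath K es np.
have -> : n%:Z - 1 = n.-1%:Z by lia.
exact: reg_JG_le_of_reg_le.
Qed.
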